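(* For positive integers $k,m$, $$\begin{aligned}\mathrm{DCT\text{-}4}_{2km}={}&K^{2km}_k\,(K^{2m}_2\otimes\mathrm{DCT\text{-}4}_k)\,Y^{2km}_m\,(\mathrm{DCT\text{-}3}_m\otimes L^{2k}_2)\,(K^{2km}_{2k})^T\\ &\times\left(I_k\otimes\begin{pmatrix}1\\ &L_2^{2(m-1)}(I_{m-1}\otimes\mathrm{DFT}_2)\\ &&1\end{pmatrix}\right)(K^{2km}_{2m})^T.\end{aligned}$$ Here $Y^{2km}_m$ is a $2$-sparse matrix (that is, a matrix with each row containing only two non-zero entries), specified by $$Y^{2km}_m=\bigoplus_{j=0}^{m-1}\begin{pmatrix} X_k(r^{(j)}) & (-1)^jJ_kX_k(1-r^{(j)}) \\ X_k(1-r^{(j)}) & (-1)^{j+1}J_kX_k(r^{(j)})\end{pmatrix},\qquad r^{(j)}=\frac{2j+1}{4m},$$ with $X_k(r)$ as defined in the context. This factorization is obtained by inducing the subalgebra $\mathcal{B}=\langle T_{2k}(x)\rangle$ of the algebra $\mathcal{A}=\mathbb{C}[x]/T_{2km}(x)$ with transversal $t_{2j}(x)=V_j(x)$ and $t_{2j+1}(x)=W_j(x)\,(V_{2k-1}(x)-V_{2k}(x))/2$ for $0\le j<k$; in particular these polynomials form a transversal of $\mathcal{B}$ in $\mathcal{A}$, i.e. $\mathcal{A}=\bigoplus_{\ell=0}^{2k-1}t_\ell(x)\mathcal{B}$ as vector spaces.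
   Context: All row/column indices start at $0$; matrices of size $0$ are empty. $\oplus$ is the block-diagonal direct sum and $\otimes$ the Kronecker product. Transforms, with $a$ the row index and $\ell$ the column index: $\mathrm{DCT\text{-}4}_n=[\cos\frac{(a+1/2)(\ell+1/2)\pi}{n}]_{0\le a,\ell<n}$; $\mathrm{DCT\text{-}3}_n=[\cos\frac{(2a+1)\ell\pi}{2n}]_{0\le a,\ell<n}$; $\mathrm{DFT}_2=\begin{pmatrix}1&1\\ 1&-1\end{pmatrix}$. $I_n$ is the identity; $J_n$ has $(a,n-1-a)$ entries $1$ and all others $0$. For $k\mid n$, $L_k^n$ is the $n\times n$ permutation matrix selecting elements at stride $k$: with $n=km'$, row $jm'+i$ has its $1$ in column $ik+j$, for $0\le i<m'$, $0\le j<k$. For $k\mid n$ with $n=km'$, $K_k^n=(I_{m'}\oplus J_{m'}\oplus I_{m'}\oplus J_{m'}\oplus\cdots)L_k^n$, with $k$ alternating diagonal blocks of size $m'$. $X_k(r)$ is the $k\times k$ matrix $$X_k(r)=\begin{pmatrix} c_0 & & & s_{k-1} \\ & \ddots & {\cdot}^{{\cdot}^{\cdot}} & \\ & {\cdot}^{{\cdot}^{\cdot}} & \ddots & \\ s_0 & & & c_{k-1}\end{pmatrix},\qquad c_\ell=\cos\frac{(1-2r)(2\ell+1)\pi}{4k},\quad s_\ell=\sin\frac{(1-2r)(2\ell+1)\pi}{4k},$$ i.e. $X_k(r)=\mathrm{diag}(c_\ell)_{0\le\ell<k}+J_k\,\mathrm{diag}(s_\ell)_{0\le\ell<k}$ (for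 odd $k$ the central entry is the sum $c_{(k-1)/2}+s_{(k-1)/2}$). $T_\ell,V_\ell,W_\ell$ are the Chebyshev polynomials of the first, third and fourth kind: each satisfies $C_{\ell+1}=2xC_\ell-C_{\ell-1}$, with $T_0=1,T_1=x$; $V_0=1,V_1=2x-1$; $W_0=1,W_1=2x+1$. $\langle r(x)\rangle$ is the subalgebra of $\mathcal{A}$ of all (finite) polynomial expressions $\sum_i c_ir^i(x)$ modulo $T_{2km}(x)$, $c_i\in\mathbb{C}$. A transversal of $\mathcal{B}$ in $\mathcal{A}$ is a list of polynomials $t_0,\dots,t_{L-1}\in\mathcal{A}$ with $\mathcal{A}=\bigoplus_{\ell=0}^{L-1}t_\ell(x)\mathcal{B}$ as vector spaces. ''Obtained by inducing'' means: the regular module $\mathcal{A}$ is written as this direct sum (the induction of the regular module $\mathcal{B}$), each summand $t_\ell(x)\mathcal{B}$ is decomposed into irreducible $\mathcal{B}$-modules, and the result is then decomposed into irreducible $\mathcal{A}$-modules; the matrices of these steps give the factorization.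
   Formalization: The claim that each row of Y has only two non-zero entries fails for k ≥ 2 (for k=2, m=1 every row has four); instead, each row of every k×k block of Y's summands is shown to have exactly two non-zero entries (one in the central row for odd k). *)

(* Defs.v *)
From HB Require Import structures.
From mathcomp Require Import all_boot all_order all_algebra all_field.
From mathcomp Require Import boolp reals trigo.
From mathcomp Require Import complex mxtens.
Set Implicit Arguments.
Unset Strict Implicit.
Unset Printing Implicit Defensive.
Import Order.TTheory GRing.Theory Num.Theory.
Local Open Scope ring_scope.

(* Structured matrices.  The Kronecker product is [A *t B] of mxtens, whose
   row (i, j) has number i * p + j, where p is the number of rows of B. *)

Definition recast {T : Type} {p n : nat} (e : p = n) (A : 'M[T]_p) : 'M[T]_n :=
  castmx (e, e) A.

Lemma dsum_size (q p : nat) : (\sum_(j < q) p = q * p)%N.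
Proof. by rewrite sum_nat_const card_ord. Qed.

Section StructuredMatrices.
Variable R : pzRingType.

Definition dsum (q p : nat) (B : 'I_q -> 'M[R]_p) : 'M[R]_(q * p) :=
  recast (dsum_size q p) (\mxdiag_(j < q) B j).

Definition Jmx (n : nat) : 'M[R]_n := \matrix_(a, b) (a + b == n.-1)%N%:R.

(* The paper's L_k^n with n = k * q: row a = j * q + i has its 1 in column
   i * k + j. *)
Definition Lmx (k q : nat) : 'M[R]_(k * q) :=
  \matrix_(a, b) (b == (a %% q) * k + a %/ q :> nat)%N%:R.

(* The paper's K_k^n with n = k * q. *)
Definition Kmx (k q : nat) : 'M[R]_(k * q) :=
  dsum (fun j : 'I_k => if odd j then Jmx q else 1%:M) *m Lmx k q.

Definition DFT2 : 'M[R]_2 := \matrix_(a, b) (-1) ^+ (a * b)%N.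

(* The middle block L_2^(2(m-1)) (I_(m-1) (x) DFT_2) is empty when m = 1. *)
Definition butterfly (m : nat) : 'M[R]_(1 + (2 * m.-1 + 1)) :=
  block_mx 1%:M 0 0
    (block_mx (Lmx 2 m.-1 *m recast (mulnC m.-1 2) (1%:M *t DFT2)) 0 0 1%:M).

Definition row_nnz (p q : nat) (A : 'M[R]_(p, q)) (i : 'I_p) : nat :=
  #|[set j | A i j != 0]|.

End StructuredMatrices.

Arguments Jmx {R} n.
Arguments Lmx {R} k q.
Arguments Kmx {R} k q.
Arguments butterfly {R} m.

Section Transforms.
Variable R : realType.

Definition DCT4 (n : nat) : 'M[R]_n :=
  \matrix_(a, l) cos ((a%:R + 2^-1) * (l%:R + 2^-1) * pi / n%:R).

Definition DCT3 (n : nat) : 'M[R]_n :=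
  \matrix_(a, l) cos ((2 * a%:R + 1) * l%:R * pi / (2 * n%:R)).

Definition Xmx (k : nat) (r : R) : 'M[R]_k :=
  let angle (l : 'I_k) := (1 - 2 * r) * (2 * l%:R + 1) * pi / (4 * k%:R) in
  diag_mx (\row_l cos (angle l)) + Jmx k *m diag_mx (\row_l sin (angle l)).

Definition Yblock (k m j : nat) : 'M[R]_(k + k) :=
  let r := (2 * j%:R + 1) / (4 * m%:R) in
  block_mx
    (Xmx k r)       ((-1) ^+ j *: (Jmx k *m Xmx k (1 - r)))
    (Xmx k (1 - r)) ((-1) ^+ j.+1 *: (Jmx k *m Xmx k r)).

Definition Ymx (k m : nat) : 'M[R]_(m * (k + k)) :=
  dsum (fun j : 'I_m => Yblock k m j).

(* Each row has exactly two non-zero entries, one on the diagonal and one on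
   the antidiagonal; for odd k these two positions coincide in the central
   row. *)
Definition two_sparse_block (k : nat) (A : 'M[R]_k) : Prop :=
  forall i : 'I_k, row_nnz A i = (if i.*2.+1 == k then 1 else 2)%N.

End Transforms.

Arguments DCT4 {R} n.
Arguments DCT3 {R} n.
Arguments Ymx {R} k m.

Section Sizes.
Variables k m : nat.
Lemma size_Kk : (k * (2 * m) = 2 * k * m)%N.
Proof. by rewrite mulnCA mulnA. Qed.
Lemma size_KD : (2 * m * k = 2 * k * m)%N.
Proof. by rewrite mulnAC. Qed.
Lemma size_Y : (m * (k + k) = 2 * k * m)%N.
Proof. by rewrite addnn -mul2n mulnC. Qed.
Lemma size_DL : (m * (2 * k) = 2 * k * m)%N.
Proof. by rewrite mulnC. Qed.
Lemma size_B (hm : (0 < m)%N) : (k * (1 + (2 * m.-1 + 1)) = 2 * k * m)%N.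
Proof.
by rewrite addnCA -[(1 + 1)%N]/(2 * 1)%N -mulnDr addn1 prednK // size_Kk.
Qed.
End Sizes.

Section Chebyshev.
Variable F : nzRingType.

Fixpoint cheb (c0 c1 : {poly F}) (n : nat) : {poly F} :=
  match n with
  | 0 => c0
  | n1.+1 => match n1 with
             | 0 => c1
             | n2.+1 => 2 *: 'X * cheb c0 c1 n1 - cheb c0 c1 n2
             end
  end.

Definition chebT := cheb 1 'X.
Definition chebV := cheb 1 (2 *: 'X - 1).
Definition chebW := cheb 1 (2 *: 'X + 1).
End Chebyshev.

Arguments chebT {F} n.
Arguments chebV {F} n.
Arguments chebW {F} n.

HB.instance Definition _ (F : fieldType) (h : {poly F}) :=
  Vector.on {poly %/ h}.

(* [{poly %/ h}] is the quotient by h only for monic h, hence the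
   normalisation; it does not change the ideal (see [quo_eqE]). *)
Definition monicize (F : fieldType) (p : {poly F}) : {poly F} :=
  (lead_coef p)^-1 *: p.

Definition to_quo (F : fieldType) (p f : {poly F}) : {poly %/ monicize p} :=
  in_qpoly (monicize p) f.

Lemma quo_eqE (F : fieldType) (p f g : {poly F}) :
  (1 < size p)%N -> (to_quo p f == to_quo p g) = (p %| f - g).
Proof.
move=> sp; have p0 : p != 0 by rewrite -size_poly_gt0 (ltn_trans _ sp).
have c0 : (lead_coef p)^-1 != 0 by rewrite invr_eq0 lead_coef_eq0.
have pM : monicize p \is monic.
  by rewrite monicE lead_coefZ mulVf // lead_coef_eq0.
have hE : mk_monic (monicize p) = monicize p.
  by rewrite /mk_monic size_scale // sp pM.
rewrite -val_eqE /= hE -!Pdiv.IdomainMonic.modpE //.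
rewrite -subr_eq0 -modpN -modpD -(dvdpZl _ _ c0) /dvdp.
by apply/eqP/eqP.
Qed.

Section Induction.
Variables (F : fieldType) (aT : falgType F).

(* The subalgebra of all polynomial expressions in r (see [gen_subalgP]). *)
Definition gen_subalg (r : aT) : {vspace aT} := <<1; r>>%VS.

Lemma gen_subalgP (r x : aT) :
  reflect (exists f : {poly F}, x = \sum_(i < size f) f`_i *: r ^+ i)
          (x \in gen_subalg r).
Proof.
have hornerE f : horner_alg r f = \sum_(i < size f) f`_i *: r ^+ i.
  rewrite -{1}[f]coefK poly_def linear_sum /=; apply: eq_bigr => i _.
  by rewrite -mul_polyC rmorphM rmorphXn /= horner_algC horner_algX mulr_algl.
apply: (iffP idP) => [|[f ->]]; last first.
  apply: rpred_sum => i _; apply: rpredZ.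
  rewrite memvE -expv_line (subv_trans _ (subX_agenv _ i)) //.
  by rewrite expvS ?addvSr.
suff: x \in gen_subalg r -> exists f, x = horner_alg r f.
  by move=> H /H[f ->]; exists f.
have sumE (n : nat) (v : 'I_n -> aT) :
    (forall i, exists f, v i = horner_alg r f) ->
    exists f, \sum_i v i = horner_alg r f.
  move=> /fin_all_exists[f vE]; exists (\sum_i f i).
  by rewrite linear_sum; apply: eq_bigr => i _.
have powE n : ((1 + <[r]>) ^+ n <= \sum_(j < n.+1) <[r ^+ j]>)%VS.
  elim: n => [|n IHn]; first by rewrite expv0 big_ord1 expr0.
  rewrite expvSl (subv_trans (prodvSr _ IHn)) // prodvDl prod1v subv_add.
  apply/andP; split; first by rewrite [X in (_ <= X)%VS]big_ord_recr addvSl.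
  rewrite big_distrr /= [X in (_ <= X)%VS]big_ord_recl.
  rewrite (subv_trans _ (addvSr _ _)) //.
  by under eq_bigr => j _ do rewrite prodv_line -exprS.
case/memv_sumP => v vU ->; apply: (sumE _) => i.
case/memv_sumP: (subvP (powE i) _ (vU i isT)) => w wU ->; apply: sumE => j.
have /vlineP[c ->] := wU j isT.
by exists (c *: 'X^j);
  rewrite -mul_polyC rmorphM rmorphXn /= horner_algC horner_algX mulr_algl.
Qed.

Variable B : {vspace aT}.

(* t B, as the image of B under b |-> t * b. *)
Definition tsub (t : aT) : {vspace aT} := (amull t @: B)%VS.

Definition subalg_transversal (L : nat) (t : 'I_L -> aT) : Prop :=
  directv (\sum_(l < L) tsub (t l))%VS /\ (\sum_(l < L) tsub (t l) = fullv)%VS.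

Definition submodule (W : {vspace aT}) : Prop := (B * W <= W)%VS.

Definition irreducible_module (W : {vspace aT}) : Prop :=
  [/\ W != 0%VS, submodule W &
      forall U : {vspace aT}, submodule U -> (U <= W)%VS -> U = 0%VS \/ U = W].
End Induction.

Section InducedFactorization.
Variables (F : fieldType) (aT : falgType F) (n : nat).

(* M takes coordinates (columns) in the basis b to coordinates in c. *)
Definition base_change (b c : n.-tuple aT) (M : 'M[F]_n) : Prop :=
  [/\ basis_of fullv b, basis_of fullv c &
      forall j : 'I_n, tnth b j = \sum_(i < n) M i j *: tnth c i].

(* The vectors of c labelled l by lab form a basis of t_l B, for each l. *)
Definition adapted_basis (B : {vspace aT}) (L : nat) (t : 'I_L -> aT)
    (c : n.-tuple aT) (lab : 'I_n -> 'I_L) : Prop :=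
  forall l, basis_of (tsub B (t l)) [seq tnth c i | i <- enum 'I_n & lab i == l].

(* b is the given basis of the regular module.  In turn, Mind writes it as the
   direct sum of the t_l B, Msub decomposes every t_l B into irreducible
   B-modules, and Mdec decomposes the outcome into irreducible modules over the
   whole algebra; Four is the resulting decomposition matrix of the regular
   module.  All irreducible modules here are spanned by one basis vector, as is
   the case over the complex numbers for commutative algebras.  Since the four
   matrices are fixed, c, d and e are determined by b. *)
Definition induced_factorization (B : {vspace aT}) (L : nat) (t : 'I_L -> aT)
    (b : n.-tuple aT) (Four Mdec Msub Mind : 'M[F]_n) : Prop :=
  exists c d e : n.-tuple aT,
  [/\ base_change b c Mind, base_change c d Msub, base_change d e Mdec
    & base_change b e Four] /\
  [/\ exists lab, adapted_basis B t c lab,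
      exists lab, adapted_basis B t d lab,
      forall i : 'I_n, irreducible_module B <[tnth d i]>%VS
    & forall i : 'I_n, irreducible_module fullv <[tnth e i]>%VS].
End InducedFactorization.

Section DCT4Induction.
Variables (R : realType) (k m : nat).
Local Notation C := R[i].

Definition Aalg : falgType C := {poly %/ monicize (chebT (F := C) (2 * k * m))}.

Definition Abasis : (2 * k * m).-tuple Aalg :=
  [tuple to_quo (chebT (2 * k * m)) (chebV j) | j < 2 * k * m].

Definition Bsub : {vspace Aalg} :=
  gen_subalg (to_quo (chebT (2 * k * m)) (chebT (2 * k)) : Aalg).

(* Index 2 * j + 1 carries the polynomials with W_j, index 2 * j those with
   V_j. *)
Definition transv_poly (l : nat) : {poly C} :=
  if odd l then 2^-1 *: (chebW l./2 * (chebV (2 * k).-1 - chebV (2 * k)))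
  else chebV l./2.

Definition transv (l : 'I_(2 * k)) : Aalg :=
  to_quo (chebT (2 * k * m)) (transv_poly l).
End DCT4Induction.

Definition toC (R : realType) (p q : nat) (A : 'M[R]_(p, q)) : 'M[R[i]]_(p, q) :=
  map_mx (real_complex R) A.

(* Main.v *)
Require Import Defs.
From HB Require Import structures.
From mathcomp Require Import all_boot all_order all_algebra all_field.
From mathcomp Require Import boolp reals trigo.
From mathcomp Require Import complex mxtens.
From mathcomp Require Import zify ring lra.
Set Implicit Arguments.
Unset Strict Implicit.
Unset Printing Implicit Defensive.
Import Order.TTheory GRing.Theory Num.Theory.
Local Open Scope ring_scope.

(* An element u of A = C[x]/T_{2km} is determined by its values at the zeros
   cos theta_p of T_{2km}, theta_p = (p + 1/2) pi / (2km); we weight them by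
   cos (theta_p / 2), which turns the column V_j into the j-th column of DCT-4
   and t_{2a}, t_{2a+1} into cos ((a + 1/2) theta) and
   sin ((a + 1/2) theta) sin (2k theta).  The zeros of T_{2km} lie over the
   zeros cos phi_s of T_m through cos (2k theta_p) = cos phi_s.  If l_s are the
   Lagrange polynomials of the cos phi_s, then the intermediate basis d
   consists of t_{2a} l_s(T_{2k}) and t_{2a+1} U_{m-1}(T_{2k}) l_s(T_{2k});
   since sin (2k theta_p) U_{m-1}(cos (2k theta_p)) = sin (2km theta_p) =
   (-1)^p, its weighted values are cos ((a + 1/2) theta_p) and
   (-1)^p sin ((a + 1/2) theta_p), restricted to the p over s.  These are the
   entries of the product of the first three factors, by the addition formulas
   (the skew DCT-4).  The remaining factors act on such columns by the
   addition formulas too, which gives the matrix identity.  Expanding the V_j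
   through the factors one after another shows that each intermediate family
   spans A, hence is a basis, and dim B <= m forces the sum of the t_l B to be
   direct. *)

(** * Entries of structured matrices *)

Lemma big_mxtens (R : nmodType) (q p : nat) (F : 'I_(q * p) -> R) :
  \sum_x F x = \sum_(j < q) \sum_(i < p) F (mxtens_index (j, i)).
Proof.
rewrite pair_bigA (reindex (@mxtens_index q p)) /=.
  by apply: eq_bigr => -[].
by exists (@mxtens_unindex q p) => x _; rewrite ?mxtens_indexK ?mxtens_unindexK.
Qed.

(** Links the two numberings in play: [dsum] comes from a block matrix indexed by a dependent sum,
    everything else uses Kronecker pairs. *)
Lemma dsumE (R : pzRingType) (q p : nat) (B : 'I_q -> 'M[R]_p) j i j' i' :
  dsum B (mxtens_index (j, i)) (mxtens_index (j', i')) =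
  if j == j' then B j i i' else 0.
Proof.
(* The rank of [(u, v)] is the total size of the blocks before [u] plus [v], that is [u * p + v], as
   all blocks have size [p]. *)
have rankE (u : 'I_q) (v : 'I_p) :
    cast_ord (esym (dsum_size q p)) (mxtens_index (u, v)) =
    tagnat.Rank u v :> 'I_(\sum_(j < q) p).
  apply: val_inj; rewrite [RHS](@tagnat.RankEsum q (fun=> p) u v) /=.
  congr addn; rewrite -[X in (X * _)%N](@card_ord u) -sum_nat_const.
  by rewrite (big_ord_widen _ (fun=> p) (ltnW (ltn_ord u))).
rewrite /dsum /recast castmxE !rankE.
have /matrixP/(_ i i') := @mxblockK _ q q (fun=> p) (fun=> p)
  (fun i j : 'I_q => if i == j then conform_mx 0 (B i) else 0) j j'.
rewrite !mxE => ->; case: eqP => _; first by rewrite conform_mx_id.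
by rewrite mxE.
Qed.

Lemma flip_subproof (b : bool) (q : nat) (i : 'I_q) :
  ((if b then q.-1 - i else i) < q)%N.
Proof. by case: b => //; have := ltn_ord i; lia. Qed.

Definition flip b q (i : 'I_q) : 'I_q := Ordinal (flip_subproof b i).

Lemma flipK b q : involutive (@flip b q).
Proof. by move=> i; apply: val_inj; case: b => //=; have := ltn_ord i; lia. Qed.

(* Row [kidx j i] of K_k^(k q) has its 1 in column [i k + j]. *)
Definition kidx (k q : nat) (j : 'I_k) (i : 'I_q) : 'I_(k * q) :=
  mxtens_index (j, flip (odd j) i).

Lemma kidxP (k q : nat) (x : 'I_(k * q)) : exists j i, x = kidx j i.
Proof.
case: (mxtens_indexP x) => j i.
by exists j, (flip (odd j) i); rewrite /kidx flipK.
Qed.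

Section StructuredEntries.
Variable R : pzRingType.

Lemma LmxE k q (j : 'I_k) (i : 'I_q) b :
  Lmx k q (mxtens_index (j, i)) b = (b == i * k + j :> nat)%N%:R :> R.
Proof.
rewrite mxE /= modnMDl modn_small // divnMDl ?divn_small ?addn0 //.
by apply: leq_ltn_trans (ltn_ord i).
Qed.

(** The blocks [I] and [J] undo the flip built into [kidx], which leaves row [(j, i)] of the stride
    permutation. *)
Lemma KmxE k q (j : 'I_k) (i : 'I_q) b :
  Kmx k q (kidx j i) b = (b == i * k + j :> nat)%N%:R :> R.
Proof.
rewrite mxE big_mxtens (bigD1 j) //= [X in _ + X]big1 ?addr0 => [|j' nj];
  last first.
  by apply: big1 => i' _; rewrite dsumE eq_sym (negPf nj) mul0r.
rewrite (bigD1 i) //= big1 ?addr0 => [|i' ni].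
  rewrite dsumE eqxx LmxE; case: (odd j); rewrite !mxE; last first.
    by rewrite (_ : _ == _) ?mul1r //; apply/eqP/val_inj.
  by rewrite /= subnK ?eqxx ?mul1r //; have := ltn_ord i; lia.
rewrite dsumE eqxx LmxE; case: (odd j); rewrite !mxE; last first.
  rewrite (_ : _ == _ = false) ?mul0r //; apply/eqP => /(congr1 val) /= e.
  by move/eqP: ni; apply; apply: val_inj.
rewrite (_ : _ == _ = false) ?mul0r //; apply/eqP => /= e.
case/eqP: ni; apply: val_inj => /=.
by have := ltn_ord i; have := ltn_ord i'; lia.
Qed.

Lemma recastE (p n : nat) (e : p = n) (A : 'M[R]_p) i j :
  recast e A (cast_ord e i) (cast_ord e j) = A i j.
Proof. by case: n / e; rewrite /recast castmx_id !cast_ord_id. Qed.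

Lemma big_cast_ord (T : nmodType) (p n : nat) (e : p = n) (F : 'I_n -> T) :
  \sum_x F x = \sum_(x < p) F (cast_ord e x).
Proof. by case: n / e F => F; apply: eq_bigr => x _; rewrite cast_ord_id. Qed.

Lemma mulmx_sel (n p : nat) (A : 'M[R]_n) (M : 'M[R]_(n, p)) a a' c :
  (forall b, A a b = (b == a')%:R) -> (A *m M) a c = M a' c.
Proof.
move=> Aa; rewrite mxE (bigD1 a') //= big1 ?addr0 => [|b nb].
  by rewrite Aa eqxx mul1r.
by rewrite Aa (negPf nb) mul0r.
Qed.

Lemma mulmx_trsel (n p : nat) (A : 'M[R]_n) (M : 'M[R]_(p, n)) a a' c :
  (forall b, A a b = (b == a')%:R) -> (M *m A^T) c a = M c a'.
Proof.
move=> Aa; rewrite mxE (bigD1 a') //= big1 ?addr0 => [|b nb].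
  by rewrite mxE Aa eqxx mulr1.
by rewrite mxE Aa (negPf nb) mulr0.
Qed.

Lemma Kmx_mulE (k q n p : nat) (e : (k * q = n)%N) (M : 'M[R]_(n, p))
    (j : 'I_k) (i : 'I_q) (a' : 'I_n) c :
  a' = (i * k + j)%N :> nat ->
  (recast e (Kmx k q) *m M) (cast_ord e (kidx j i)) c = M a' c.
Proof.
move=> a'E; apply: mulmx_sel => b.
rewrite -[b](cast_ordKV e) recastE KmxE -a'E.
by rewrite -val_eqE.
Qed.

Lemma mul_trKmxE (k q n p : nat) (e : (k * q = n)%N) (M : 'M[R]_(p, n))
    (j : 'I_k) (i : 'I_q) (a' : 'I_n) c :
  a' = (i * k + j)%N :> nat ->
  (M *m (recast e (Kmx k q))^T) c (cast_ord e (kidx j i)) = M c a'.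
Proof.
move=> a'E; apply: mulmx_trsel => b.
by rewrite -[b](cast_ordKV e) recastE KmxE -a'E -val_eqE.
Qed.

End StructuredEntries.

(** * Cosine transforms and the skew DCT-4 *)

Section Trigonometry.
Variable R : realType.
Implicit Types r x y z : R.

Lemma cosDnpi n x : cos (x + n%:R * pi) = (-1) ^+ n * cos x.
Proof. by rewrite mulr_natl (alternatingn (@cosDpi R)). Qed.

Lemma cosSS n x :
  cos (n.+2%:R * x) = 2 * cos x * cos (n.+1%:R * x) - cos (n%:R * x).
Proof.
have -> : n.+2%:R * x = n.+1%:R * x + x
  by rewrite -[n.+2]addn1 natrD mulrDl mul1r.
have -> : n%:R * x = n.+1%:R * x - x
  by rewrite -[n.+1]addn1 natrD mulrDl mul1r addrK.
rewrite cosB cosD; ring.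
Qed.

(** By the recurrence [cosSS], cos (n x) is a polynomial in cos x. This lets 2k theta_p be replaced
    by [node m s], which shares only its cosine. *)
Lemma cos_natmul_eq n x y : cos x = cos y -> cos (n%:R * x) = cos (n%:R * y).
Proof.
move=> xy; elim/ltn_ind: n => -[|[|n]] IH; rewrite ?mul0r ?mul1r //.
by rewrite !cosSS xy !IH.
Qed.

(* The zeros of T_n are the [cos (node n p)], [p < n]. *)
Definition node (n p : nat) : R := (p%:R + 2^-1) * pi / n%:R.

Lemma DCT4E n (a l : 'I_n) : DCT4 n a l = cos ((l%:R + 2^-1) * node n a) :> R.
Proof. by rewrite mxE; congr cos; rewrite /node; ring. Qed.

Lemma DCT3E n (a l : 'I_n) : DCT3 n a l = cos (l%:R * node n a) :> R.
Proof.
have n0 : n%:R != 0 :> R by rewrite pnatr_eq0; have := ltn_ord a; lia.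
by rewrite mxE; congr cos; rewrite /node; field.
Qed.

(** Reversal turns l + 1/2 into n - (l + 1/2), and n * [node n a] is (a + 1/2) pi. This is how [J]
    produces sines from a cosine transform. *)
Lemma DCT4_rev n (a l : 'I_n) :
  DCT4 n a (rev_ord l) = (-1) ^+ a * sin ((l%:R + 2^-1) * node n a) :> R.
Proof.
have n0 : n%:R != 0 :> R by rewrite pnatr_eq0; have := ltn_ord a; lia.
rewrite DCT4E /= natrB // -[l.+1]addn1 natrD.
have -> : (n%:R - (l%:R + 1) + 2^-1) * node n a =
    - ((l%:R + 2^-1) * node n a - pi / 2) + a%:R * pi by rewrite /node; field.
by rewrite cosDnpi cosN cosBpihalf.
Qed.

Lemma sum_mul_delta n (f : 'I_n -> R) (a : 'I_n) :
  \sum_v f v * (v == a)%:R = f a.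
Proof.
rewrite (bigD1 a) //= eqxx mulr1 big1 ?addr0 // => v /negPf->.
by rewrite mulr0.
Qed.

Lemma XmxE k r (v a : 'I_k) (z := (1 - 2 * r) * pi / (2 * k%:R)) :
  Xmx k r v a = (v == a)%:R * cos ((a%:R + 2^-1) * z) +
                (v == rev_ord a)%:R * sin ((a%:R + 2^-1) * z).
Proof.
have k0 : k%:R != 0 :> R by rewrite pnatr_eq0; have := ltn_ord a; lia.
have angleE (l : 'I_k) :
    (1 - 2 * r) * (2 * l%:R + 1) * pi / (4 * k%:R) = (l%:R + 2^-1) * z.
  by rewrite /z; field.
have av := ltn_ord a; have vk := ltn_ord v.
rewrite /Xmx mul_mx_diag mxE; congr (_ + _).
  rewrite mxE [X in X *+ _]mxE angleE -[LHS]mulr_natl.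
  by case: eqVneq => [->|]; rewrite ?mul0r.
rewrite mxE [X in _ * X]mxE angleE [X in X * _]mxE; congr (_%:R * _).
congr nat_of_bool; apply/idP/idP => /eqP e; apply/eqP; last
  by rewrite e /=; lia.
by apply: val_inj => /=; lia.
Qed.

Lemma sum_Xmx k r (f : 'I_k -> R) (a : 'I_k)
    (z := (1 - 2 * r) * pi / (2 * k%:R)) :
  \sum_v f v * Xmx k r v a = f a * cos ((a%:R + 2^-1) * z) +
                             f (rev_ord a) * sin ((a%:R + 2^-1) * z).
Proof.
under eq_bigr => v _ do rewrite XmxE -/z mulrDr !(mulrA (f v)).
by rewrite big_split /= -!mulr_suml !sum_mul_delta.
Qed.

Lemma mul_JmxE k (A : 'M[R]_k) v a : (Jmx k *m A) v a = A (rev_ord v) a.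
Proof.
rewrite mxE (bigD1 (rev_ord v)) //= mxE big1 ?addr0 => [|i ni].
  by rewrite (_ : _ == _) ?mul1r //=; have := ltn_ord v; lia.
rewrite mxE (_ : _ == _ = false) ?mul0r //; apply: contraNF ni => /eqP e.
by rewrite -val_eqE /=; have := ltn_ord v; lia.
Qed.

(** The antidiagonal of [Xmx] meets a reversed column of DCT-4, which is a signed sine, so the sum
    is the addition formula for the cosine; the sign moves into the angle by parity. *)
Lemma sum_DCT4_Xmx k r (j a : 'I_k) (z := (1 - 2 * r) * pi / (2 * k%:R)) :
  \sum_v DCT4 k j v * Xmx k r v a =
  cos ((a%:R + 2^-1) * (node k j - (-1) ^+ j * z)).
Proof.
rewrite sum_Xmx DCT4_rev DCT4E -/z mulrBr cosB mulrCA.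
by rewrite -signr_odd; case: odd;
  rewrite ?(expr1, expr0, mul1r, mulN1r, mulrN, cosN, sinN); ring.
Qed.

(** The extra [J] exchanges the roles of the sine and the cosine columns, which gives the addition
    formula for the sine instead. *)
Lemma sum_DCT4_JXmx k r (j a : 'I_k) (z := (1 - 2 * r) * pi / (2 * k%:R)) :
  \sum_v DCT4 k j v * (Jmx k *m Xmx k r) v a =
  (-1) ^+ j * sin ((a%:R + 2^-1) * (node k j + (-1) ^+ j * z)).
Proof.
rewrite (reindex_inj rev_ord_inj) /=.
under eq_bigr => v _ do rewrite mul_JmxE rev_ordK.
rewrite sum_Xmx rev_ordK DCT4_rev DCT4E -/z mulrDr sinD mulrCA.
by rewrite -signr_odd; case: odd;
  rewrite ?(expr1, expr0, mul1r, mulN1r, mulrN, cosN, sinN); ring.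
Qed.

Lemma kidx_half k q (j : 'I_k) (i : 'I_q) :
  (kidx j i)%:R + 2^-1 =
  j%:R * q%:R + (if odd j then q%:R - (i%:R + 2^-1) else i%:R + 2^-1) :> R.
Proof.
rewrite /= natrD natrM -addrA; congr (_ + _); case: odd => //=.
have := ltn_ord i; case: q i => [[] //|q] i iq.
by rewrite /= natrB ?ltnS // -(natr1 q); field.
Qed.

(* [p] runs through the zeros of T_(2km) that T_(2k) maps to [cos (node m s)]. *)
Section Nodes.
Variables (k m : nat) (j : 'I_k) (b : 'I_2) (s : 'I_m).
Let p : nat := kidx j (kidx b s).
Let r : R := (2 * s%:R + 1) / (4 * m%:R).

(** Since 2 pi r is [node m s], the shift is plus or minus (pi - [node m s]) / 2k. Each flip of
    [kidx] reflects a half-integer i + 1/2 and contributes one of the two signs. *)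
Lemma node_kidx :
  node (2 * k * m) p =
  node k j - (-1) ^+ j * ((-1) ^+ b * ((1 - 2 * r) * pi / (2 * k%:R))).
Proof.
have k0 : k%:R != 0 :> R by rewrite pnatr_eq0; have := ltn_ord j; lia.
have m0 : m%:R != 0 :> R by rewrite pnatr_eq0; have := ltn_ord s; lia.
rewrite {1}/node /p kidx_half !natrM kidx_half -[(-1) ^+ j]signr_odd.
rewrite -[(-1) ^+ b]signr_odd /r /node.
have b2 : b%:R = (odd b)%:R :> R by case: b => -[|[]].
rewrite b2; case: (odd j); case: (odd b);
  rewrite ?expr0 ?expr1 /= ?mulr1n ?mulr0n; field; by rewrite k0 m0.
Qed.

(** 2k * [node k j] is an odd multiple of pi, and 2k times the shift in [node_kidx] is plus or minus
    pi - [node m s]. *)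
Lemma cos_node_kidx : cos ((2 * k)%:R * node (2 * k * m) p) = cos (node m s).
Proof.
have k0 : k%:R != 0 :> R by rewrite pnatr_eq0; have := ltn_ord j; lia.
have m0 : m%:R != 0 :> R by rewrite pnatr_eq0; have := ltn_ord s; lia.
rewrite node_kidx mulrA -exprD -signr_odd.
have -> : (2 * k)%:R * (node k j - (-1) ^+ odd (j + b) *
    ((1 - 2 * r) * pi / (2 * k%:R))) =
  (- (-1) ^+ odd (j + b) * (pi - node m s) + pi) + j%:R * 2 * pi.
  by rewrite natrM /node /r; field; rewrite k0 m0.
rewrite -(natrM _ j) cosDnpi cosDpi mulnC exprM sqrrN !expr1n mul1r.
have c : cos (pi - node m s) = - cos (node m s) by rewrite addrC cosDpi cosN.
by case: odd; rewrite ?expr0 ?expr1 ?opprK ?mul1r ?mulN1r ?cosN c opprK.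
Qed.

(** Both flips amount to x -> 2m - 1 - x (for odd [b] the offset is m + (m - 1 - s)), which changes
    the parity. *)
Lemma sign_kidx : (-1) ^+ p = (-1) ^+ (j + b + s) :> R.
Proof.
rewrite -signr_odd -[RHS]signr_odd; congr (_ ^+ nat_of_bool _).
rewrite /p /= mulnCA; move: (j * m)%N (ltn_ord s) => t sm.
by case: b => -[|[|//]] _ /=; case oj: (odd j); lia.
Qed.
End Nodes.
End Trigonometry.

(** * The matrix factorization *)

Lemma ord2_odd (b : 'I_2) : b = odd b :> nat.
Proof. by case: b => -[|[|]]. Qed.

Lemma mulKtensmx (R : pzRingType) (k q p n c : nat) (e : (k * q * p = n)%N)
    (Q : 'M[R]_p) (M : 'M[R]_(n, c))
    (j : 'I_k) (i : 'I_q) a b (u : 'I_(k * q)) :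
  u = (i * k + j)%N :> nat ->
  (recast e (Kmx k q *t Q) *m M) (cast_ord e (mxtens_index (kidx j i, a))) b =
  \sum_v Q a v * M (cast_ord e (mxtens_index (u, v))) b.
Proof.
move=> uE; rewrite mxE (big_cast_ord e) big_mxtens (bigD1 u) //=.
rewrite [X in _ + X]big1 ?addr0 => [|u' nu].
  by apply: eq_bigr => v _; rewrite recastE tensmxE KmxE uE eqxx mul1r.
apply: big1 => v _; rewrite recastE tensmxE KmxE -uE.
by rewrite (negPf (_ : u' != u :> nat)) ?mul0r.
Qed.

Definition half (k : nat) (e : 'I_2) (a : 'I_k) : 'I_(k + k) :=
  if odd e then rshift k a else lshift k a.

Lemma val_half k e a : @half k e a = (e * k + a)%N :> nat.
Proof. by rewrite /half; case: e => -[|[|//]] i /=; rewrite ?mul1n. Qed.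

Section Butterfly.
Variables (R : pzRingType) (m : nat) (f : nat -> R).
Local Notation N := (1 + (2 * m.-1 + 1))%N.

Lemma sum_butterfly_first (u : 'I_N) :
  u = 0%N :> nat -> \sum_(w < N) f w * butterfly m w u = f 0.
Proof.
move=> u0; have -> : u = lshift _ ord0 by apply: val_inj.
rewrite big_split_ord big_ord1 /= [X in _ + X]big1 ?addr0 => [|w _].
  by rewrite block_mxEul mxE eqxx mulr1.
by rewrite block_mxEdl mxE mulr0.
Qed.

Lemma sum_butterfly_last (u : 'I_N) :
  u = (2 * m.-1).+1 :> nat -> \sum_(w < N) f w * butterfly m w u = f u.
Proof.
move=> uN; have -> : u = rshift _ (rshift _ ord0).
  by apply: val_inj; rewrite /= uN; lia.
rewrite big_split_ord big_ord1 /= block_mxEur mxE mulr0 add0r.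
rewrite big_split_ord big_ord1 /= [X in X + _]big1 ?add0r => [|w _].
  by rewrite !block_mxEdr mxE eqxx mulr1.
by rewrite block_mxEdr block_mxEur mxE mulr0.
Qed.

(** Column [(i, v)] of I (x) DFT_2 has the entries 1 and (-1)^v. The stride permutation moves them
    to rows i and m - 1 + i, and the leading 1 shifts both by one. *)
Lemma sum_butterfly_mid (i : 'I_m.-1) (v : 'I_2) (u : 'I_N) :
  u = (i * 2 + v).+1 :> nat ->
  \sum_(w < N) f w * butterfly m w u =
  f i.+1 + (-1) ^+ v * f (m + i)%N.
Proof.
move=> uE; have -> : u = rshift _ (lshift _
    (cast_ord (mulnC m.-1 2) (mxtens_index (i, v)))).
  by apply: val_inj; rewrite /= uE; lia.
rewrite big_split_ord big_ord1 /= block_mxEur mxE mulr0 add0r.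
rewrite big_split_ord big_ord1 /= block_mxEdr block_mxEdl mxE mulr0 addr0.
have im := ltn_ord i.
rewrite big_mxtens !big_ord_recl big_ord0 addr0 -/ord0.
have LE (j : 'I_2) (i' : 'I_m.-1) :
    butterfly m (rshift 1 (lshift 1 (mxtens_index (j, i'))))
      (rshift 1 (lshift 1 (cast_ord (mulnC m.-1 2) (mxtens_index (i, v))))) =
    (i' == i)%:R * (-1) ^+ (j * v)%N :> R.
  rewrite block_mxEdr block_mxEul.
  rewrite (@mulmx_sel _ _ _ _ _ _
    (cast_ord (mulnC m.-1 2) (mxtens_index (i', j)))).
    by rewrite recastE tensmxE !mxE.
  by move=> b; rewrite LmxE -val_eqE.
have sumE (j : 'I_2) : \sum_(i' < m.-1)
   f (1 + mxtens_index (j, i'))%N *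
   butterfly m (rshift 1 (lshift 1 (mxtens_index (j, i'))))
     (rshift 1 (lshift 1 (cast_ord (mulnC m.-1 2) (mxtens_index (i, v))))) =
    f (1 + (j * m.-1 + i))%N * (-1) ^+ (j * v)%N.
  rewrite (bigD1 i) //= big1 ?addr0 => [|i' ni]; first by rewrite LE eqxx mul1r.
  by rewrite LE (negPf ni) mul0r mulr0.
rewrite !sumE /= /bump /= !mul0n mulr1 !mul1n; congr (f _ + _).
by rewrite commr_sign; congr (_ * f _); lia.
Qed.
End Butterfly.

Section Factors.
Variables (R : realType) (k m : nat).
Local Notation n := (2 * k * m)%N.

Definition Mdec : 'M[R]_n :=
  recast (size_Kk k m) (Kmx k (2 * m)) *m
  recast (size_KD k m) (Kmx 2 m *t DCT4 k) *m
  recast (size_Y k m) (Ymx k m).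

Definition Msub : 'M[R]_n := recast (size_DL k m) (DCT3 m *t Lmx 2 k).

(* Columns of [Mdec] and rows of [Msub]: column [e k + a] of block [s] belongs to
   [t_(2a+e)] and to the eigenvalue [cos (node m s)] of [T_(2k)]. *)
Definition dec_idx (s : 'I_m) (e : 'I_2) (a : 'I_k) : 'I_n :=
  cast_ord (size_DL k m) (mxtens_index (s, mxtens_index (e, a))).

Definition decval (p : nat) (e : 'I_2) (a : 'I_k) : R :=
  let x := (a%:R + 2^-1) * node R n p in
  if odd e then (-1) ^+ p * sin x else cos x.

(** With [rb] the four blocks take one form: passing from r to 1 - r negates 1 - 2r, so [rb] absorbs
    the sign (-1)^b of [node_kidx]. *)
Lemma YblockE (s : 'I_m) (b e : 'I_2) (v a : 'I_k)
    (r := (2 * s%:R + 1) / (4 * m%:R) : R) :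
  let rb := if odd b then 1 - r else r in
  Yblock R k m s (half b v) (half e a) =
  if odd e then (-1) ^+ (s + b) * (Jmx k *m Xmx k (1 - rb)) v a
  else Xmx k rb v a.
Proof.
rewrite /Yblock -/r /half.
rewrite [in (s + b)%N]ord2_odd.
case: (odd b); case: (odd e) => /=.
- by rewrite block_mxEdr mxE addn1 opprB addrC subrK.
- by rewrite block_mxEdl.
- by rewrite block_mxEur mxE addn0.
- by rewrite block_mxEul.
Qed.

(** The two [K] permutations group the zeros by their image [cos (node m s)], so row [p] meets only
    block [s] of [Ymx]. Inside it, DCT-4 times [Xmx] is evaluated by the addition formulas. *)
Lemma MdecE (p : 'I_n) :
  exists2 s : 'I_m, cos ((2 * k)%:R * node R n p) = cos (node R m s) &
  forall s' e a, Mdec p (dec_idx s' e a) = (s == s')%:R * decval p e a.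
Proof.
have [j [w pE]] := kidxP (cast_ord (esym (size_Kk k m)) p).
have [b [s wE]] := kidxP w.
have {}pE : p = cast_ord (size_Kk k m) (kidx j (kidx b s)).
  by rewrite -wE -pE cast_ordKV.
exists s => [|s' e a]; first by rewrite pE cos_node_kidx.
pose y := half e a.
have -> : dec_idx s' e a = cast_ord (size_Y k m) (mxtens_index (s', y)).
  apply: val_inj => /=; rewrite /y; congr (_ * _ + _)%N; first by lia.
  by rewrite val_half.
rewrite pE /Mdec -mulmxA.
rewrite (@Kmx_mulE _ _ _ _ _ _ _ _ _
  (cast_ord (size_KD k m) (mxtens_index (kidx b s, j)))) //.
rewrite (@mulKtensmx _ _ _ _ _ _ _ _ _ _ _ _ _
  (cast_ord (mulnC m 2) (mxtens_index (s, b)))) //.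
pose x (v : 'I_k) := half b v.
have xE v : cast_ord (size_KD k m)
      (mxtens_index (cast_ord (mulnC m 2) (mxtens_index (s, b)), v))
    = cast_ord (size_Y k m) (mxtens_index (s, x v)).
  apply: val_inj => /=; rewrite /x mulnDl -addnA; congr addn; first by lia.
  by rewrite val_half.
under eq_bigr => v _ do rewrite xE recastE dsumE.
case: (eqVneq s s') => [_|_]; last
  by rewrite mul0r big1 // => v _; rewrite mulr0.
rewrite mul1r /decval (_ : nat_of_ord (cast_ord _ _) = kidx j (kidx b s)) //.
rewrite node_kidx sign_kidx.
have signb : (-1) ^+ b = if odd b then -1 else 1 :> R.
  by rewrite (ord2_odd b); case: odd.
set r := (2 * s%:R + 1) / (4 * m%:R).
set rb := if odd b then 1 - r else r.
have rbE : (-1) ^+ b * ((1 - 2 * r) * pi / (2 * k%:R)) =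
    (1 - 2 * rb) * pi / (2 * k%:R).
  by rewrite signb /rb; case: odd; rewrite ?mul1r //; ring.
rewrite rbE; under eq_bigr => v _ do rewrite /x YblockE -/r -/rb.
case: (odd e); last by rewrite sum_DCT4_Xmx.
under eq_bigr => v _ do rewrite mulrCA.
(* The sign (-1)^(s + b) of [Y] and the (-1)^j of the sine sum combine to (-1)^p by [sign_kidx]; the
   parameter 1 - [rb] negates the angle once more. *)
rewrite -mulr_sumr sum_DCT4_JXmx [LHS]mulrA -exprD; congr (_ * sin (_ * _)).
  by congr (_ ^+ _); lia.
by ring.
Qed.

(** Only the block of [p] contributes, and its DCT-3 entry cos (i * [node m s]) is T_i evaluated at
    T_(2k)(cos theta_p). *)
Lemma mul_Mdec_MsubE (p q : 'I_n) (i : 'I_m) (a : 'I_k) (e : 'I_2) :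
  q = (i * (2 * k) + (a * 2 + e))%N :> nat ->
  (Mdec *m Msub) p q = cos (i%:R * ((2 * k)%:R * node R n p)) * decval p e a.
Proof.
move=> qE; have [s cs decE] := MdecE p.
pose l := cast_ord (mulnC k 2) (mxtens_index (a, e)).
have {qE} -> : q = cast_ord (size_DL k m) (mxtens_index (i, l))
  by apply: val_inj.
rewrite mxE (big_cast_ord (size_DL k m)) big_mxtens (bigD1 s) //=.
rewrite [X in _ + X]big1 ?addr0 => [|s' ns]; last first.
  apply: big1 => y _; case: (mxtens_indexP y) => e' a'.
  by rewrite decE eq_sym (negPf ns) !mul0r.
rewrite big_mxtens (bigD1 e) //= (bigD1 a) //=.
have subE e' a' :
    Msub (dec_idx s e' a') (cast_ord (size_DL k m) (mxtens_index (i, l))) =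
    DCT3 m s i * (l == a' * 2 + e' :> nat)%N%:R.
  by rewrite recastE tensmxE LmxE.
rewrite decE eqxx mul1r subE eqxx mulr1 DCT3E (cos_natmul_eq i cs) mulrC.
rewrite !big1 ?addr0 // => [e' ne|a' na].
  rewrite big1 // => a' _; rewrite subE [_ == _](_ : _ = false) ?mulr0 //.
  apply: contraNF ne => /eqP /= h; rewrite -val_eqE /=.
  have := ltn_ord e; have := ltn_ord e'; lia.
rewrite subE [_ == _](_ : _ = false) ?mulr0 //.
apply: contraNF na => /eqP /= h; rewrite -val_eqE /=; lia.
Qed.

Hypothesis hm : (0 < m)%N.

Definition Mind : 'M[R]_n :=
  (Kmx (2 * k) m)^T *m
  recast (size_B k hm) (1%:M *t butterfly m) *m
  (recast (size_KD k m) (Kmx (2 * m) k))^T.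

(** m * 2k * theta_p equals (p + 1/2) pi, an odd multiple of pi / 2. *)
Lemma cos_compl (p : 'I_n) x :
  cos (m%:R * ((2 * k)%:R * node R n p) - x) = (-1) ^+ p * sin x.
Proof.
have k0 : k%:R != 0 :> R by rewrite pnatr_eq0; have := ltn_ord p; lia.
have m0 : m%:R != 0 :> R by rewrite pnatr_eq0; lia.
have -> : m%:R * ((2 * k)%:R * node R n p) - x = - (x - pi / 2) + p%:R * pi.
  by rewrite /node !natrM; field; rewrite k0 m0.
by rewrite cosDnpi cosN cosBpihalf.
Qed.

(** The permutation puts the m columns of t_(2i) before those of t_(2i+1) and reverses the latter.
    There, with l = w - m + 1, the frequency is m - l, and [cos_compl] turns (-1)^p cos ((m - l) x)
    into sin (l x). *)
Lemma Mdec_Msub_KmxTE (p : 'I_n) (i : 'I_k) w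
    (x := (2 * k)%:R * node R n p) (y := (i%:R + 2^-1) * node R n p) :
  (Mdec *m Msub *m (Kmx (2 * k) m)^T) p
      (cast_ord (size_B k hm) (mxtens_index (i, w))) =
  if (w < m)%N then cos (w%:R * x) * cos y else sin ((w - m).+1%:R * x) * sin y.
Proof.
have ik := ltn_ord i; have wm : (w < 2 * m)%N by have := ltn_ord w; lia.
have vP (v : 'I_(2 * k)) (w' : 'I_m) :
    (i * (1 + (2 * m.-1 + 1)) + w =
      v * m + (if odd v then m.-1 - w' else w'))%N ->
    (Mdec *m Msub *m (Kmx (2 * k) m)^T) p
      (cast_ord (size_B k hm) (mxtens_index (i, w))) =
    (Mdec *m Msub) p (cast_ord (size_DL k m) (mxtens_index (w', v))).
  move=> e; have := @mul_trKmxE R _ _ _ _ (erefl n) (Mdec *m Msub) v w'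
    (cast_ord (size_DL k m) (mxtens_index (w', v))) p erefl.
  rewrite cast_ord_id => <-; rewrite /recast castmx_id.
  by congr (_ _ _); apply: val_inj.
case: ltnP => wlt.
  have v2 : (i * 2 < 2 * k)%N by lia.
  rewrite (vP (Ordinal v2) (Ordinal wlt)) /=; last by rewrite oddM andbF; nia.
  by rewrite (@mul_Mdec_MsubE _ _ (Ordinal wlt) i ord0) //= addn0.
have v2 : (i * 2 + 1 < 2 * k)%N by lia.
have w2 : (m.-1 - (w - m) < m)%N by lia.
rewrite (vP (Ordinal v2) (Ordinal w2)) /=; last
  by rewrite oddD oddM andbF /=; nia.
rewrite (@mul_Mdec_MsubE _ _ (Ordinal w2) i ord_max) //= /decval /=.
rewrite [LHS]mulrA -/y [_ * (-1) ^+ _]mulrC; congr (_ * _).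
have -> : (m.-1 - (w - m) = m - (w - m).+1)%N by lia.
rewrite natrB; last by lia.
by rewrite mulrBl cos_compl mulrA -exprD addnn -mul2n exprM sqrrN !expr1n mul1r.
Qed.

(** Column [kidx u i] of DCT-4 is cos (u x / 2 + y) for even u and cos ((u + 1) x / 2 - y) for odd
    u. The butterfly forms these from the products cos cos and sin sin of the preceding lemma. *)
Lemma DCT4_factor : DCT4 n = Mdec *m Msub *m Mind.
Proof.
apply/matrixP => p t.
have [u [i tE]] := kidxP (cast_ord (esym (size_KD k m)) t).
have {}tE : t = cast_ord (size_KD k m) (kidx u i) by rewrite -tE cast_ordKV.
have uP : (u < 1 + (2 * m.-1 + 1))%N by have := ltn_ord u; lia.
pose u' := Ordinal uP.
rewrite tE /Mind !mulmxA.
rewrite (@mul_trKmxE _ _ _ _ _ _ _ _ _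
  (cast_ord (size_B k hm) (mxtens_index (i, u')))); last first.
  by rewrite /= (_ : 1 + (2 * m.-1 + 1) = 2 * m)%N //; lia.
set H := Mdec *m Msub *m _.
rewrite [RHS]mxE (big_cast_ord (size_B k hm)) big_mxtens (bigD1 i) //=.
rewrite [X in _ + X]big1 ?addr0 => [|i' ni]; last first.
  apply: big1 => w _.
  by rewrite recastE tensmxE [1%:M _ _]mxE (negPf ni) mul0r mulr0.
set x := (2 * k)%:R * node R n p; set y := (i%:R + 2^-1) * node R n p.
pose f w := if (w < m)%N then cos (w%:R * x) * cos y
  else sin ((w - m).+1%:R * x) * sin y.
under eq_bigr => w _ do
  rewrite /H Mdec_Msub_KmxTE recastE tensmxE [1%:M _ _]mxE
    eqxx mul1r -/x -/y -/(f w).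
rewrite DCT4E (_ : nat_of_ord (cast_ord _ _) = kidx u i) // kidx_half.
have [u0|[ul|[j [v uE]]]] : (u = 0%N :> nat) \/ (u = (2 * m.-1).+1 :> nat) \/
    exists (j : 'I_m.-1) (v : 'I_2), u = (j * 2 + v).+1 :> nat.
- case: (u =P 0%N :> nat) => [|u0]; first by left.
  case: (u =P (2 * m.-1).+1 :> nat) => [|ul]; first by right; left.
  right; right; have jP : (u.-1 %/ 2 < m.-1)%N by have := ltn_ord u; lia.
  exists (Ordinal jP), (Ordinal (ltn_pmod u.-1 (isT : 0 < 2)%N)) => /=; lia.
- by rewrite sum_butterfly_first // u0 /= /f hm !mul0r add0r cos0 mul1r.
(* The last column is cos (m x - y), where cos (m x) = 0 leaves the single term sin (m x) sin y. *)
- rewrite sum_butterfly_last //= ul /f (_ : (_ < m)%N = false); last by lia.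
  rewrite (_ : ((2 * m.-1).+1 - m).+1 = m); last by lia.
  have := cos_compl p 0; rewrite -/x subr0 sin0 mulr0 => cosmx.
  rewrite oddS oddM /= [X in cos X](_ : _ = m%:R * x - y).
    by rewrite cosB cosmx mul0r add0r.
  rewrite /x /y (_ : (2 * m.-1).+1 = 2 * m - 1)%N; last by lia.
  rewrite natrB ?natrM; last by lia.
  by ring.
- have uE' : u' = (j * 2 + v).+1 :> nat := uE.
  rewrite (sum_butterfly_mid _ uE') uE /= /f.
  have jm := ltn_ord j.
  rewrite (_ : (j.+1 < m)%N); last by lia.
  rewrite (_ : (m + j < m)%N = false); last by lia.
  rewrite (_ : (m + j - m).+1 = j.+1); last by lia.
  rewrite oddD oddM andbF addFb (ord2_odd v) oddb.
  rewrite -natr1 natrD natrM -natr1 /x natrM /y.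
  case: (odd v) => /=.
    rewrite mulN1r -cosD; congr cos; ring.
  by rewrite mul1r -cosB; congr cos; ring.
Qed.
End Factors.

(** * Sparsity *)

Section TwoSparse.
Variables (R : realType) (k : nat).
Implicit Types (x r : R) (A : 'M[R]_k).

Lemma two_sparse_JmxM A : two_sparse_block A -> two_sparse_block (Jmx k *m A).
Proof.
move=> sA i; rewrite /row_nnz; under eq_finset => j do rewrite mul_JmxE.
have := sA (rev_ord i); rewrite /row_nnz => ->; congr (if _ then _ else _).
by rewrite /=; have := ltn_ord i; lia.
Qed.

Lemma two_sparse_sign A n :
  two_sparse_block A -> two_sparse_block ((-1) ^+ n *: A).
Proof.
move=> sA i; rewrite -(sA i) /row_nnz; congr #|pred_of_set _|.
by apply/setP => j; rewrite !inE mxE mulf_eq0 signr_eq0.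
Qed.

Lemma cos_neq0 x : - (pi / 2) < x < pi / 2 -> cos x != 0.
Proof. by move=> /cos_gt0_pihalf; rewrite lt0r => /andP[]. Qed.

Lemma sin_neq0 x : x != 0 -> - (pi / 2) < x < pi / 2 -> sin x != 0.
Proof.
move=> x0 /andP[xl xr]; apply: contraNneq x0 => sx; apply/eqP/sin_inj.
- by rewrite in_itv /= !ltW.
- have := pi_gt0 R; rewrite in_itv /=; lra.
- by rewrite sin0.
Qed.

(** cos x + sin x divides cos (2x), which does not vanish for |2x| < pi / 2. It serves the central
    entry for odd k. *)
Lemma cosDsin_neq0 x : - (pi / 4) < x < pi / 4 -> cos x + sin x != 0.
Proof.
move=> xb; have : cos (x + x) != 0 by apply: cos_neq0; lra.
apply: contraNneq => cs; rewrite cosD.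
have -> : cos x * cos x - sin x * sin x =
  (cos x + sin x) * (cos x - sin x) by ring.
by rewrite cs mul0r.
Qed.

(** All angles are t (1 - 2r) pi / 2 with 0 < t < 1 and 0 < |1 - 2r| < 1, so neither the sines nor
    the cosines vanish. *)
Lemma two_sparse_Xmx r : 2 * r != 1 -> 0 < r < 1 -> two_sparse_block (Xmx k r).
Proof.
move=> r12 rb i; rewrite /row_nnz.
have k0 : 0 < k%:R :> R by rewrite ltr0n; have := ltn_ord i; lia.
pose t (a : 'I_k) : R := (a%:R + 2^-1) / k%:R.
have tb (a : 'I_k) : 0 < t a < 1.
  have a0 : 0 <= a%:R :> R by rewrite ler0n.
  have : (a.+1)%:R <= k%:R :> R by rewrite ler_nat ltn_ord.
  rewrite -natr1 => ak; rewrite /t divr_gt0 //=; last by lra.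
  by rewrite ltr_pdivrMr // mul1r; lra.
have tE : forall a : 'I_k, (a%:R + 2^-1) * ((1 - 2 * r) * pi / (2 * k%:R)) =
   t a * (1 - 2 * r) * (pi / 2).
  by move=> a; rewrite /t; field; rewrite lt0r_neq0.
have p0 := pi_gt0 R.
have bound a : - (pi / 2) < t a * (1 - 2 * r) * (pi / 2) < pi / 2.
  have /andP[t0 t1] := tb a.
  have: -1 < t a * (1 - 2 * r) < 1 by nra.
  by nra.
have cn a : cos (t a * (1 - 2 * r) * (pi / 2)) != 0 by apply: cos_neq0.
have sn a : sin (t a * (1 - 2 * r) * (pi / 2)) != 0.
  apply: sin_neq0 => //; have /andP[t0 t1] := tb a.
  have r0 : 1 - 2 * r != 0 by rewrite subr_eq0 eq_sym.
  apply: mulf_neq0; last by apply/lt0r_neq0/divr_gt0.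
  by apply: mulf_neq0 => //; apply: lt0r_neq0.
have revE : (rev_ord i == i) = (i.*2.+1 == k).
  apply/idP/idP => /eqP e; apply/eqP; last by apply: val_inj => /=; lia.
  by move/(congr1 val): e => /=; have := ltn_ord i; lia.
rewrite -revE (_ : [set j | _] = [set i; rev_ord i]).
  by rewrite cards2 eq_sym; case: eqP.
apply/setP => j; rewrite !inE XmxE tE.
have -> : (j == rev_ord i) = (i == rev_ord j).
  by rewrite -(inj_eq rev_ord_inj) rev_ordK eq_sym.
rewrite (eq_sym j); case: (eqVneq i j) => [<-|_].
  case: (eqVneq i (rev_ord i)) => [e|_]; last by rewrite mul1r mul0r addr0 cn.
  rewrite !mul1r cosDsin_neq0 //.
  (* Diagonal and antidiagonal meet only in the central row, where t = 1/2 brings the angle below pi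
     / 4 in absolute value. *)
  have -> : t i = 2^-1.
    move/esym/eqP: e; rewrite revE => /eqP/(congr1 (fun n => n%:R : R)).
    rewrite -natr1 -muln2 natrM => ek; rewrite /t -ek.
    by field; rewrite ek lt0r_neq0.
  by nra.
by case: (i == rev_ord j); rewrite !(mul0r, mul1r, add0r) ?eqxx ?sn.
Qed.
End TwoSparse.

Lemma two_sparse_Yblock (R : realType) (k m : nat) (j : 'I_m) :
  [/\ two_sparse_block (ulsubmx (Yblock R k m j)),
      two_sparse_block (ursubmx (Yblock R k m j)),
      two_sparse_block (dlsubmx (Yblock R k m j))
    & two_sparse_block (drsubmx (Yblock R k m j))].
Proof.
rewrite /Yblock; set r := _ / _.
(* From 2j + 1 < 2m; hence both r and 1 - r lie in (0, 1) and differ from 1/2. *)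
have rb : 0 < r < 2^-1.
  have m0 : 0 < m%:R :> R by rewrite ltr0n; have := ltn_ord j; lia.
  have jm : (j.+1)%:R <= m%:R :> R by rewrite ler_nat ltn_ord.
  have j0 : 0 <= j%:R :> R by rewrite ler0n.
  rewrite /r ltr_pdivrMr ?divr_gt0 ?mulr_gt0 //=; first
    by rewrite -natr1 in jm; lra.
  lra.
have X1 : two_sparse_block (Xmx k r) by apply: two_sparse_Xmx; lra.
have X2 : two_sparse_block (Xmx k (1 - r)) by apply: two_sparse_Xmx; lra.
rewrite block_mxKul block_mxKur block_mxKdl block_mxKdr.
by split=> //; apply/two_sparse_sign/two_sparse_JmxM.
Qed.

(** * Values of Chebyshev polynomials *)

Section ChebyshevValues.
Variable F : comNzRingType.

Lemma chebSS (c0 c1 : {poly F}) n :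
  cheb c0 c1 n.+2 = 2 *: 'X * cheb c0 c1 n.+1 - cheb c0 c1 n.
Proof. by []. Qed.

(** The recurrence is linear, so a common factor [w] can be carried along. This yields the second,
    third and fourth kinds without dividing by a sine or cosine that may vanish. *)
Lemma horner_cheb (c0 c1 : {poly F}) x w (f : nat -> F) :
  c0.[x] * w = f 0 -> c1.[x] * w = f 1 ->
  (forall n, f n.+2 = 2 * x * f n.+1 - f n) ->
  forall n, (cheb c0 c1 n).[x] * w = f n.
Proof.
move=> f0 f1 fS; elim/ltn_ind=> -[|[|n]] IH //.
rewrite chebSS fS -!IH // hornerD hornerN hornerM hornerZ hornerX; ring.
Qed.
End ChebyshevValues.

Lemma size_cheb (F : idomainType) (c1 : {poly F}) n :
  2 != 0 :> F -> size c1 = 2 -> size (cheb 1 c1 n) = n.+1.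
Proof.
move=> two0 s1; elim/ltn_ind: n => -[|[|n]] IH //; first exact: size_poly1.
have s2X : size (2 *: 'X * cheb 1 c1 n.+1) = n.+3.
  by rewrite -scalerAl size_scale // mulrC size_mulX ?IH // -size_poly_eq0 IH.
by rewrite chebSS size_polyDl ?s2X // size_polyN IH.
Qed.

Lemma size_chebT (F : idomainType) n :
  2 != 0 :> F -> size (chebT n : {poly F}) = n.+1.
Proof. by move=> two0; apply: size_cheb => //; apply: size_polyX. Qed.

Lemma size_chebV (F : idomainType) n :
  2 != 0 :> F -> size (chebV n : {poly F}) = n.+1.
Proof.
move=> two0; apply: size_cheb => //.
by rewrite size_polyDl ?size_polyN ?size_poly1 size_scale ?size_polyX.
Qed.

Section ComplexValues.
Variables (R : realType) (x : R).
Local Open Scope complex_scope.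
Local Notation X := ((cos x)%:C).

Lemma cosD_cosB y : cos (y + x) = 2 * cos x * cos y - cos (y - x).
Proof. by rewrite cosD cosB; ring. Qed.

Lemma sinD_sinB y : sin (y + x) = 2 * cos x * sin y - sin (y - x).
Proof. by rewrite sinD sinB; ring. Qed.

Lemma horner_cheb_real (c0 c1 : {poly R[i]}) w (f : nat -> R) :
  c0.[X] * w%:C = (f 0)%:C -> c1.[X] * w%:C = (f 1)%:C ->
  (forall n, f n.+2 = 2 * cos x * f n.+1 - f n) ->
  forall n, (cheb c0 c1 n).[X] * w%:C = (f n)%:C.
Proof.
move=> f0 f1 fS; apply: (horner_cheb (f := fun n => (f n)%:C)) => // n.
by rewrite fS !(rmorphB, rmorphM, rmorph_nat).
Qed.

Lemma horner_chebT n : (chebT n).[X] = (cos (n%:R * x))%:C.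
Proof.
rewrite -[LHS]mulr1; apply: (@horner_cheb_real _ _ 1 (fun n => cos (n%:R * x))).
- by rewrite mul0r cos0 !hornerE.
- by rewrite mul1r !hornerE.
- by move=> j; rewrite cosSS.
Qed.

Lemma horner_chebV n :
  (chebV n).[X] * (cos (2^-1 * x))%:C = (cos ((n%:R + 2^-1) * x))%:C.
Proof.
apply: (@horner_cheb_real _ _ _ (fun n => cos ((n%:R + 2^-1) * x))).
- by rewrite add0r !hornerE ?mul1r.
- have -> : cos ((1 + 2^-1) * x) = (2 * cos x - 1) * cos (2^-1 * x).
    rewrite mulrDl mul1r addrC cosD_cosB -[_ - x]opprB cosN.
    by rewrite (_ : x - _ = 2^-1 * x); [ring|field].
  by rewrite !hornerE rmorphM rmorphB rmorphM rmorph1 rmorph_nat.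
- move=> j; rewrite (_ : (j.+2%:R + _) * x = (j.+1%:R + 2^-1) * x + x).
    by rewrite cosD_cosB; congr (_ - cos _); rewrite -(natr1 j); ring.
  by rewrite -(natr1 j.+1); ring.
Qed.

Lemma horner_chebW n :
  (chebW n).[X] * (sin (2^-1 * x))%:C = (sin ((n%:R + 2^-1) * x))%:C.
Proof.
apply: (@horner_cheb_real _ _ _ (fun n => sin ((n%:R + 2^-1) * x))).
- by rewrite add0r !hornerE ?mul1r.
- have -> : sin ((1 + 2^-1) * x) = (2 * cos x + 1) * sin (2^-1 * x).
    rewrite mulrDl mul1r addrC sinD_sinB -[_ - x]opprB sinN.
    by rewrite (_ : x - _ = 2^-1 * x); [ring|field].
  by rewrite !hornerE rmorphM rmorphD rmorphM rmorph1 rmorph_nat.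
- move=> j; rewrite (_ : (j.+2%:R + _) * x = (j.+1%:R + 2^-1) * x + x).
    by rewrite sinD_sinB; congr (_ - sin _); rewrite -(natr1 j); ring.
  by rewrite -(natr1 j.+1); ring.
Qed.

(** [cheb 1 (2 *: 'X)] is the Chebyshev polynomial of the second kind. *)
Lemma horner_chebU n :
  (cheb 1 (2 *: 'X) n).[X] * (sin x)%:C = (sin (n.+1%:R * x))%:C.
Proof.
apply: (@horner_cheb_real _ _ _ (fun n => sin (n.+1%:R * x))).
- by rewrite !mul1r !hornerE ?mul1r.
- have -> : sin (2%:R * x) = (2 * cos x) * sin x.
    by rewrite mulr2n mulrDl mul1r sinD; ring.
  by rewrite !hornerE !rmorphM rmorph_nat.
- move=> j; rewrite (_ : j.+3%:R * x = j.+2%:R * x + x).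
    by rewrite sinD_sinB; congr (_ - sin _); rewrite -(natr1 j.+1); ring.
  by rewrite -(natr1 j.+2); ring.
Qed.

Lemma horner_transv_even k a :
  (transv_poly R k (a * 2)).[X] * (cos (2^-1 * x))%:C =
  (cos ((a%:R + 2^-1) * x))%:C.
Proof. by rewrite /transv_poly oddM andbF muln2 doubleK horner_chebV. Qed.

(** Weighted by cos (x / 2), half the difference of V_(2k-1) and V_(2k) is sin (2k x) sin (x / 2),
    and sin (x / 2) is just the weight that W_a calls for. *)
Lemma horner_transv_odd k a : (0 < k)%N ->
  (transv_poly R k (a * 2 + 1)).[X] * (cos (2^-1 * x))%:C =
  (sin ((a%:R + 2^-1) * x) * sin ((2 * k)%:R * x))%:C.
Proof.
move=> hk; rewrite /transv_poly oddD oddM andbF /=.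
rewrite (_ : (a * 2 + 1)./2 = a); last by lia.
rewrite hornerZ hornerM hornerD hornerN -!mulrA mulrBl !horner_chebV.
have -> : (2 * k).-1%:R + 2^-1 = (2 * k)%:R - 2^-1 :> R.
  by rewrite -subn1 natrB; [field|lia].
rewrite mulrBl mulrDl cosB cosD -rmorphB.
have -> : cos ((2 * k)%:R * x) * cos (2^-1 * x) +
  sin ((2 * k)%:R * x) * sin (2^-1 * x) -
  (cos ((2 * k)%:R * x) * cos (2^-1 * x) -
   sin ((2 * k)%:R * x) * sin (2^-1 * x)) =
   sin (2^-1 * x) * (2 * sin ((2 * k)%:R * x)) by ring.
rewrite [in LHS]rmorphM [(chebW a).[_] * (_ * _)]mulrA horner_chebW -rmorphM.
rewrite -[2^-1](_ : (2^-1)%:C = 2^-1); last by rewrite fmorphV rmorph_nat.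
by rewrite -rmorphM; congr ((_)%:C); field.
Qed.
End ComplexValues.

(** * Modules and transversals *)

Lemma dim_limg_leq (F : fieldType) (U V : vectType F) (f : 'Hom(U, V))
    (W : {vspace U}) :
  (\dim (f @: W) <= \dim W)%N.
Proof. by rewrite -(limg_ker_dim f W) leq_addl. Qed.

Section Modules.
Variables (F : fieldType) (aT : falgType F).

(** [c] spans because [b] does, and its length is the dimension. This takes the place of inverting
    [M]. *)
Lemma base_change_span n (b c : n.-tuple aT) (M : 'M[F]_n) :
  basis_of fullv b -> (forall j, tnth b j = \sum_i M i j *: tnth c i) ->
  base_change b c M.
Proof.
move=> bB bE; split=> //; rewrite basisEdim; apply/andP; split; last
  by rewrite size_tuple (size_basis bB).
rewrite -(span_basis bB); apply/span_subvP => x /tnthP[j ->].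
by rewrite bE rpred_sum // => i _; rewrite rpredZ // memv_span ?mem_tnth.
Qed.

Lemma base_change_mul n (b c d : n.-tuple aT) (M N : 'M[F]_n) :
  (forall j, tnth b j = \sum_i M i j *: tnth c i) ->
  (forall j, tnth c j = \sum_i N i j *: tnth d i) ->
  forall j, tnth b j = \sum_i (N *m M) i j *: tnth d i.
Proof.
move=> bE cE j; rewrite bE; under eq_bigr do rewrite cE scaler_sumr.
rewrite exchange_big /=; apply: eq_bigr => i _.
rewrite mxE scaler_suml; apply: eq_bigr => l _.
by rewrite scalerA mulrC.
Qed.

(** A line spanned by a common eigenvector is stable, and a line has no other subspaces than zero
    and itself. *)
Lemma irreducible_eigenline (B : {vspace aT}) (v : aT) : v != 0 ->
  (forall b, b \in B -> exists c : F, b * v = c *: v) ->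
  irreducible_module B <[v]>.
Proof.
move=> v0 eig; split.
- by rewrite -dimv_eq0 dim_vline v0.
- apply/prodvP => b w bB /vlineP[c ->]; have [l e] := eig b bB.
  by rewrite -scalerAr e !rpredZ ?memv_line.
- move=> U _ Uv; have := dimvS Uv; rewrite dim_vline v0 leq_eqVlt ltnS leqn0.
  case/orP => [/eqP d1|]; last by rewrite dimv_eq0 => /eqP; left.
  by right; apply/eqP; rewrite eqEdim Uv dim_vline v0 d1.
Qed.

Section Transversal.
Variables (n L h : nat) (B : {vspace aT}) (t : 'I_L -> aT).
Variables (c : n.-tuple aT) (lab : 'I_n -> 'I_L).
Hypothesis c_basis : basis_of fullv c.
Hypothesis c_in : forall i, tnth c i \in tsub B (t (lab i)).
Hypothesis dimB : (\dim B <= h)%N.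

Lemma dim_tsub l : (\dim (tsub B (t l)) <= h)%N.
Proof. exact: leq_trans (dim_limg_leq _ _) dimB. Qed.

(** The vectors labelled [l] are free, as part of a basis, and there are at least [h] of them in a
    space of dimension at most [h]. *)
Lemma adapted_basis_card :
  (forall l, h <= #|[set i | lab i == l]|)%N -> adapted_basis B t c lab.
Proof.
move=> cardP l; set s := [seq _ | _ <- _ & _].
have s_free : free s.
  have := basis_free c_basis; rewrite -{1}(map_tnth_enum c).
  rewrite -(perm_free (perm_map _
    (permEl (perm_filterC (fun i => lab i == l) _)))).
  by rewrite map_cat; apply: catl_free.
rewrite basisEfree s_free /=; apply/andP; split.
  apply/span_subvP/(@allP _ (mem (tsub B (t l)))); rewrite all_map.
  by apply/allP => i; rewrite mem_filter /= => /andP[/eqP <- _]; apply: c_in.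
rewrite size_map; apply: leq_trans (dim_tsub l) _.
apply: leq_trans (cardP l) _.
by rewrite size_filter -sum1_count big_enum_cond /= sum1dep_card.
Qed.

(** The sum contains a basis, so it is everything; the dimensions of the summands add up to at most
    L h <= n, which forces directness. *)
Lemma subalg_transversal_basis : (L * h <= n)%N -> subalg_transversal B t.
Proof.
move=> Lh; have full : (\sum_(l < L) tsub B (t l) = fullv)%VS.
  apply/eqP; rewrite eqEsubv subvf -(span_basis c_basis) /=.
  apply/span_subvP => x /tnthP[i ->].
  exact: subvP (sumv_sup (lab i) _ (subvv _)) _ (c_in i).
split=> //; rewrite directvEgeq /= full (size_basis c_basis).
apply: leq_trans Lh; rewrite -[L in (_ <= L * _)%N]card_ord -sum_nat_const.
by apply: leq_sum => l _; apply: dim_tsub.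
Qed.
End Transversal.
End Modules.

(** * The algebra C[x]/T_(2km) *)

Lemma mk_monic_monicize (F : fieldType) (p : {poly F}) :
  (1 < size p)%N -> mk_monic (monicize p) = monicize p.
Proof.
move=> sp; have p0 : p != 0 by rewrite -size_poly_gt0 (ltn_trans _ sp).
by rewrite /mk_monic size_scale ?invr_eq0 ?lead_coef_eq0 // sp monicE lead_coefZ
  mulVf ?lead_coef_eq0 ?eqxx.
Qed.

Lemma lagrange_exists (F : fieldType) (I : finType) (x : I -> F) : injective x ->
  exists L : I -> {poly F}, forall i j, (L i).[x j] = (i == j)%:R.
Proof.
move=> xI; pose P i := \prod_(j | j != i) ('X - (x j)%:P).
exists (fun i => (P i).[x i]^-1 *: P i) => i j; rewrite hornerZ.
have [<-|ij] := eqVneq i j.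
  rewrite mulVf // horner_prod; apply/prodf_neq0 => l li.
  by rewrite hornerXsubC subr_eq0 inj_eq // eq_sym.
rewrite [X in _ * X]horner_prod (bigD1 j) 1?eq_sym //=.
by rewrite hornerXsubC subrr mul0r mulr0.
Qed.

Lemma chebV_span (F : idomainType) N (p : {poly F}) : 2 != 0 :> F ->
  (forall n, lead_coef (chebV n : {poly F}) \is a GRing.unit) ->
  (size p <= N)%N -> exists c : 'I_N -> F, p = \sum_(j < N) c j *: chebV j.
Proof.
move=> two0 lu; elim: N p => [|N IH] p.
  by rewrite leqn0 size_poly_eq0 => /eqP->; exists (fun=> 0); rewrite big_ord0.
(* [a] is chosen to cancel the coefficient of degree N, since V_N has degree exactly N. *)
move=> sp; pose a := p`_N / lead_coef (chebV N : {poly F}).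
have [|c cE] := IH (p - a *: chebV N).
  apply/leq_sizeP => j; rewrite leq_eqVlt => /orP[/eqP<-|Nj];
    rewrite coefB coefZ.
    have -> : (chebV N : {poly F})`_N = lead_coef (chebV N : {poly F})
      by rewrite lead_coefE size_chebV.
    by rewrite divrK ?subrr.
  by rewrite !nth_default ?mulr0 ?subr0 ?size_chebV //; apply: leq_trans Nj.
exists (fun j => oapp c a (unlift ord_max j)).
rewrite big_ord_recr /= unlift_none /= -[LHS](subrK (a *: chebV N)) cE.
congr (_ + _); apply: eq_bigr => j _.
by rewrite (_ : widen_ord _ _ = lift ord_max j) ?liftK //;
  apply: val_inj; rewrite /= /bump leqNgt ltn_ord.
Qed.

Lemma toC_mul (R : realType) (p q r : nat) (M : 'M[R]_(p, q))
    (N : 'M[R]_(q, r)) :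
  toC (M *m N) = toC M *m toC N.
Proof. exact: map_mxM. Qed.

Section NodeBounds.
Variables (R : realType) (n : nat).

Lemma node_itv p : (p < n)%N -> 0 < node R n p < pi.
Proof.
move=> pn; have n0 : 0 < n%:R :> R by rewrite ltr0n; lia.
have p1 : (p.+1)%:R <= n%:R :> R by rewrite ler_nat.
have p0 : 0 <= p%:R :> R by rewrite ler0n.
have pi0 := pi_gt0 R; rewrite /node ltr_pdivrMr // divr_gt0 //=.
  by rewrite -natr1 in p1; nra.
by apply: mulr_gt0 => //; lra.
Qed.

Lemma cos_node_inj p q : (p < n)%N -> (q < n)%N ->
  cos (node R n p) = cos (node R n q) -> p = q.
Proof.
move=> pn qn /cos_inj; rewrite !in_itv /=.
have /andP[p0 p1] := node_itv pn; have /andP[q0 q1] := node_itv qn.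
rewrite !ltW // => /(_ isT isT).
have n0 : n%:R != 0 :> R by rewrite pnatr_eq0; lia.
move/(mulIf (invr_neq0 n0))/(mulIf (lt0r_neq0 (pi_gt0 R)))/addIr/eqP.
by rewrite eqr_nat => /eqP.
Qed.
End NodeBounds.

(** * Evaluation at the zeros of T_(2km) *)

Section Algebra.
Variables (R : realType) (k m : nat).
Hypotheses (hk : (0 < k)%N) (hm : (0 < m)%N).
Local Notation n := (2 * k * m)%N.
Local Notation C := R[i].
Local Notation T := (chebT n : {poly C}).
Local Notation A := (Aalg R k m).
Local Open Scope complex_scope.

Definition chebT_root (p : nat) : C := (cos (node R n p))%:C.

Definition ev (p : nat) (u : A) : C :=
  ((u : {poly %/ monicize T}) : {poly C}).[chebT_root p].

Lemma two_neq0 : 2 != 0 :> C. Proof. by rewrite pnatr_eq0. Qed.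

Lemma size_Amod : size (mk_monic (monicize T)) = n.+1.
Proof.
have sT : size T = n.+1 by apply/size_chebT/two_neq0.
rewrite mk_monic_monicize ?sT; last by lia.
by rewrite size_scale ?sT // invr_eq0 lead_coef_eq0 -size_poly_eq0 sT.
Qed.

Lemma dimA : \dim {:A} = n.
Proof. by rewrite [LHS]dim_polyn size_Amod. Qed.

Lemma n_neq0 : n%:R != 0 :> R. Proof. by rewrite pnatr_eq0; lia. Qed.

Lemma Amod_root p : (mk_monic (monicize T)).[chebT_root p] = 0.
Proof.
rewrite mk_monic_monicize; last by rewrite size_chebT ?two_neq0 //; lia.
rewrite hornerZ horner_chebT.
have -> : n%:R * node R n p = pi / 2 + p%:R * pi.
  by rewrite /node; move: n_neq0; move: (n%:R) => N N0; field.
by rewrite cosDnpi cos_pihalf mulr0 rmorph0 mulr0.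
Qed.

(** Reduction subtracts a multiple of the modulus, which vanishes at the zero; so evaluation is well
    defined on the quotient. *)
Lemma ev_quo p f : ev p (to_quo T f) = f.[chebT_root p].
Proof.
have hM := monic_mk_monic (monicize T).
rewrite /ev /= [in RHS](Pdiv.RingMonic.rdivp_eq hM f) hornerD hornerM Amod_root.
by rewrite mulr0 add0r.
Qed.

Lemma to_quoK (u : A) : to_quo T (u : {poly %/ monicize T}) = u.
Proof.
by apply: val_inj; apply: in_qpoly_small; apply: size_mk_monic.
Qed.

Lemma evM p (u v : A) : ev p (u * v) = ev p u * ev p v.
Proof.
rewrite -[u in LHS]to_quoK -[v in LHS]to_quoK.
by rewrite -[_ * _](in_qpolyM (monicize T)) [LHS]ev_quo hornerM.
Qed.

Lemma ev1 p : ev p 1 = 1.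
Proof. by rewrite -[1](in_qpoly1 (monicize T)) [LHS]ev_quo hornerC. Qed.

Lemma evX p (u : A) j : ev p (u ^+ j) = ev p u ^+ j.
Proof. by elim: j => [|j IH]; rewrite ?ev1 // !exprS evM IH. Qed.

Lemma evZ p a (u : A) : ev p (a *: u) = a * ev p u.
Proof. by rewrite /ev -hornerZ. Qed.

Lemma ev_sum p (I : finType) (F : I -> A) :
  ev p (\sum_i F i) = \sum_i ev p (F i).
Proof.
apply: (big_morph (ev p)) => [u v|]; first by rewrite /ev -hornerD.
by rewrite /ev horner0.
Qed.

Definition weight (p : nat) : R := cos (2^-1 * node R n p).

Lemma weight_neq0 (p : 'I_n) : (weight p)%:C != 0.
Proof.
rewrite (fmorph_eq0 (real_complex R)) cos_neq0 //.
have := node_itv R (ltn_ord p); have := pi_gt0 R; lra.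
Qed.

Lemma chebT_root_inj p q :
  (p < n)%N -> (q < n)%N -> chebT_root p = chebT_root q -> p = q.
Proof. by move=> pn qn /complexI; apply: cos_node_inj. Qed.

(** The representatives have degree below n and agree at n distinct points. *)
Lemma ev_inj (u v : A) : (forall p : 'I_n, ev p u = ev p v) -> u = v.
Proof.
move=> uv; apply: val_inj; apply/eqP; rewrite -subr_eq0; apply/eqP.
pose rs := [seq chebT_root p | p : 'I_n].
apply: (@roots_geq_poly_eq0 _ _ rs).
- apply/allP => x /mapP[p _ ->]; rewrite /root hornerD hornerN subr_eq0.
  by apply/eqP/uv.
- rewrite map_inj_uniq ?enum_uniq // => p q /chebT_root_inj e.
  by apply: val_inj; apply: e.
- rewrite size_map size_enum_ord; apply: leq_trans (size_polyD _ _) _.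
  have sz (w : {poly %/ monicize T}) : (size w <= n)%N.
    by rewrite -ltnS -size_Amod; apply: size_mk_monic.
  by rewrite size_polyN geq_max !sz.
Qed.

Lemma weighted_ev_inj (u v : A) :
  (forall p : 'I_n, ev p u * (weight p)%:C = ev p v * (weight p)%:C) -> u = v.
Proof. by move=> uv; apply: ev_inj => p; apply: (mulIf (weight_neq0 p)). Qed.

Lemma Abasis_basis : basis_of fullv (Abasis R k m).
Proof.
rewrite basisEdim dimA size_tuple leqnn andbT; apply/subvP => u _.
have [||c uE] := @chebV_span C n (u : {poly %/ monicize T}) two_neq0.
- by move=> j; rewrite unitfE lead_coef_eq0 -size_poly_eq0 size_chebV ?two_neq0.
- by rewrite -ltnS -size_Amod; apply: size_mk_monic.
rewrite (_ : u = \sum_j c j *: tnth (Abasis R k m) j).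
  by rewrite rpred_sum // => j _; rewrite rpredZ // memv_span ?mem_tnth.
apply: ev_inj => p; rewrite ev_sum {1}/ev uE horner_sum.
by apply: eq_bigr => j _; rewrite evZ tnth_mktuple ev_quo hornerZ.
Qed.

(** The element f(T_(2k)) of the subalgebra, in the form supplied by [gen_subalgP]. *)
Definition polyr (f : {poly C}) : A :=
  \sum_(i < size f) f`_i *: (to_quo T (chebT (2 * k)) : A) ^+ i.

Lemma polyr_in f : polyr f \in Bsub R k m.
Proof. by apply/gen_subalgP; exists f. Qed.

Lemma ev_polyr p f : ev p (polyr f) = f.[(cos ((2 * k)%:R * node R n p))%:C].
Proof.
rewrite ev_sum horner_coef; apply: eq_bigr => i _.
by rewrite evZ evX ev_quo horner_chebT.
Qed.

(* The eigenvalues of T_(2k) on A. *)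
Definition nodeC (s : 'I_m) : C := (cos (node R m s))%:C.

Lemma nodeC_inj : injective nodeC.
Proof. by move=> s s' /complexI/cos_node_inj e; apply: val_inj; apply: e. Qed.

Lemma ev_polyrE (p : 'I_n) :
  exists2 s : 'I_m, forall f, ev p (polyr f) = f.[nodeC s] &
  forall s' e a, Mdec R k m p (dec_idx s' e a) =
    (s == s')%:R * @decval R k m p e a.
Proof.
by have [s cE dE] := MdecE R p; exists s => // f; rewrite ev_polyr cE.
Qed.

(** * The successive bases and their irreducible lines *)

Section Coordinates.
Variable eL : 'I_n -> {poly C}.
Hypothesis eLE : forall p q : 'I_n, (eL p).[chebT_root q] = (p == q)%:R.

(** Primitive idempotents of A, rescaled so that coordinates in this family are weighted values. *)
Definition etup : n.-tuple A :=
  [tuple to_quo T ((weight p)%:C^-1 *: eL p) : A | p < n].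

Definition comb (M : 'M[R]_n) (c : n.-tuple A) : n.-tuple A :=
  [tuple \sum_i toC M i j *: tnth c i | j < n].

Definition dtup := comb (Mdec R k m) etup.
Definition ctup := comb (Msub R k m) dtup.

Lemma tnth_comb M c j : tnth (comb M c) j = \sum_i toC M i j *: tnth c i.
Proof. by rewrite tnth_mktuple. Qed.

Lemma weighted_ev_e (p q : 'I_n) :
  ev p (tnth etup q) * (weight p)%:C = (q == p)%:R.
Proof.
rewrite tnth_mktuple ev_quo hornerZ eLE.
by case: eqVneq => [->|_]; rewrite ?mulr0 ?mul0r // mulr1 mulVf // weight_neq0.
Qed.

Lemma weighted_ev_comb M (p q : 'I_n) :
  ev p (\sum_i toC M i q *: tnth etup i) * (weight p)%:C = (M p q)%:C.
Proof.
rewrite ev_sum mulr_suml (bigD1 p) //= [X in _ + X]big1 ?addr0 => [|i ip].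
  by rewrite evZ -mulrA weighted_ev_e eqxx mulr1 mxE.
by rewrite evZ -mulrA weighted_ev_e (negPf ip) mulr0.
Qed.

Lemma weighted_ev_d (p q : 'I_n) :
  ev p (tnth dtup q) * (weight p)%:C = (Mdec R k m p q)%:C.
Proof. by rewrite tnth_comb weighted_ev_comb. Qed.

Lemma Abasis_e j :
  tnth (Abasis R k m) j = \sum_i toC (DCT4 n) i j *: tnth etup i.
Proof.
apply: weighted_ev_inj => p; rewrite weighted_ev_comb tnth_mktuple ev_quo.
by rewrite /weight /chebT_root horner_chebV DCT4E.
Qed.

(** The matrix factorization, read in [etup] coordinates. Since [Abasis] is a basis, it makes [ctup]
    one, and then [dtup] and [etup] in turn. *)
Lemma Abasis_c j :
  tnth (Abasis R k m) j = \sum_i toC (Mind R k hm) i j *: tnth ctup i.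
Proof.
rewrite -tnth_comb; have e1 := base_change_mul (tnth_comb (Mind R k hm) ctup)
  (tnth_comb (Msub R k m) dtup).
rewrite (base_change_mul e1 (tnth_comb _ _)) Abasis_e (DCT4_factor R k hm).
by rewrite (toC_mul (Mdec R k m *m Msub R k m)) (toC_mul (Mdec R k m)) -mulmxA.
Qed.

Lemma base_change_Abasis_c :
  base_change (Abasis R k m) ctup (toC (Mind R k hm)).
Proof. exact: base_change_span Abasis_basis Abasis_c. Qed.

Lemma ctup_basis : basis_of fullv ctup.
Proof. by case: base_change_Abasis_c. Qed.

Lemma base_change_c_d : base_change ctup dtup (toC (Msub R k m)).
Proof. exact: base_change_span ctup_basis (tnth_comb _ _). Qed.

Lemma dtup_basis : basis_of fullv dtup.
Proof. by case: base_change_c_d. Qed.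

Lemma base_change_d_e : base_change dtup etup (toC (Mdec R k m)).
Proof. exact: base_change_span dtup_basis (tnth_comb _ _). Qed.

Lemma etup_basis : basis_of fullv etup.
Proof. by case: base_change_d_e. Qed.

Lemma base_change_Abasis_e : base_change (Abasis R k m) etup (toC (DCT4 n)).
Proof. exact: base_change_span Abasis_basis Abasis_e. Qed.

Lemma basis_neq0 (c : n.-tuple A) i : basis_of fullv c -> tnth c i != 0.
Proof. by move/basis_free/free_not0; apply; apply: mem_tnth. Qed.

Lemma etup_irreducible i : irreducible_module fullv <[tnth etup i]>%VS.
Proof.
apply: irreducible_eigenline => [|u _]; first exact: basis_neq0 etup_basis.
exists (ev i u); apply: weighted_ev_inj => p.
rewrite evM evZ -!mulrA weighted_ev_e.
by case: eqVneq => [->//|_]; rewrite !mulr0.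
Qed.

Lemma dec_idxP (q : 'I_n) : exists s e a, q = dec_idx s e a.
Proof.
have [y yE] : exists y, q = cast_ord (size_DL k m) y.
  by exists (cast_ord (esym (size_DL k m)) q); rewrite cast_ordKV.
case: (mxtens_indexP y) yE => s z ->; case: (mxtens_indexP z) => e a.
by exists s, e, a.
Qed.

(** A vector of [dtup] vanishes off the zeros lying over one [s], and there f(T_(2k)) has the
    constant value [f.[nodeC s]]. *)
Lemma dtup_irreducible i : irreducible_module (Bsub R k m) <[tnth dtup i]>%VS.
Proof.
have [s [e [a ->]]] := dec_idxP i.
apply: irreducible_eigenline => [|u /gen_subalgP[f ->]].
  exact: basis_neq0 dtup_basis.
exists f.[nodeC s]; rewrite -/(polyr f); apply: weighted_ev_inj => p.
rewrite evM evZ -!mulrA weighted_ev_d; have [s' -> ->] := ev_polyrE p.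
by case: eqVneq => [->//|_]; rewrite mul0r !mulr0.
Qed.

(** Inside a block [dtup] is ordered by e k + a, the transversal by 2a + e; hence the swap. [ctup]
    already follows the order of the transversal. *)
Definition dlab (q : 'I_n) : 'I_(2 * k) :=
  let y := (mxtens_unindex (cast_ord (esym (size_DL k m)) q)).2 in
  cast_ord (mulnC k 2)
    (mxtens_index ((mxtens_unindex y).2, (mxtens_unindex y).1)).

Definition clab (q : 'I_n) : 'I_(2 * k) :=
  (mxtens_unindex (cast_ord (esym (size_DL k m)) q)).2.

Lemma clabE s l : clab (cast_ord (size_DL k m) (mxtens_index (s, l))) = l.
Proof. by rewrite /clab cast_ordK mxtens_indexK. Qed.

Lemma dlabE s e a :
  dlab (dec_idx s e a) = cast_ord (mulnC k 2) (mxtens_index (a, e)).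
Proof. by rewrite /dlab cast_ordK !mxtens_indexK. Qed.

Lemma clab_card l : (m <= #|[set q | clab q == l]|)%N.
Proof.
pose f (s : 'I_m) := cast_ord (size_DL k m) (mxtens_index (s, l)).
have fI : injective f.
  by move=> s s' /cast_ord_inj/(can_inj (@mxtens_indexK _ _))[].
rewrite -[m in (m <= _)%N]card_ord -(card_codom fI).
apply/subset_leq_card/subsetP => _ /codomP[s ->].
by rewrite inE clabE.
Qed.

Lemma dlab_card l : (m <= #|[set q | dlab q == l]|)%N.
Proof.
have [a [e lE]] : exists a e, l = cast_ord (mulnC k 2) (mxtens_index (a, e)).
  have [y yE] : exists y, l = cast_ord (mulnC k 2) y.
    by exists (cast_ord (esym (mulnC k 2)) l); rewrite cast_ordKV.
  by case: (mxtens_indexP y) yE => a e; exists a, e.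
pose f (s : 'I_m) : 'I_n := dec_idx s e a.
have fI : injective f.
  by move=> s s' /cast_ord_inj/(can_inj (@mxtens_indexK _ _))[].
rewrite -[m in (m <= _)%N]card_ord -(card_codom fI).
apply/subset_leq_card/subsetP => _ /codomP[s ->].
by rewrite inE dlabE lE.
Qed.

(** * Membership of the basis vectors in the summands t_l B *)

Section Membership.
Variable dL : 'I_m -> {poly C}.
Hypothesis dLE : forall s s', (dL s).[nodeC s'] = (s == s')%:R.

(** Lagrange interpolation at the m values of T_(2k) writes each element of B through m fixed
    ones. *)
Lemma dim_Bsub : (\dim (Bsub R k m) <= m)%N.
Proof.
pose F := [seq polyr (dL s) | s : 'I_m].
apply: (@leq_trans (\dim <<F>>)%VS); last first.
  by apply: leq_trans (dim_span _) _; rewrite size_map size_enum_ord.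
apply/dimvS/subvP => u /gen_subalgP[f ->]; rewrite -/(polyr f).
rewrite (_ : polyr f = \sum_s f.[nodeC s] *: polyr (dL s)).
  rewrite rpred_sum // => s _; rewrite rpredZ // memv_span //.
  by apply: map_f; rewrite mem_enum.
apply: ev_inj => p; have [s sE _] := ev_polyrE p; rewrite sE ev_sum.
rewrite (bigD1 s) //= evZ sE dLE eqxx mulr1 big1 ?addr0 // => s' ns.
by rewrite evZ sE dLE (negPf ns) mulr0.
Qed.

Lemma ev_transv p l : ev p (transv R m l) = (transv_poly R k l).[chebT_root p].
Proof. exact: ev_quo. Qed.

Lemma dtup_in q : tnth dtup q \in tsub (Bsub R k m) (transv R m (dlab q)).
Proof.
have [s [e [a ->]]] := dec_idxP q; rewrite dlabE.
(* For odd [e] the factor U_(m-1)(T_(2k)) turns the sin (2k theta_p) of the transversal element into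
   (-1)^p. *)
pose U : {poly C} := if odd e then cheb 1 (2 *: 'X) m.-1 else 1.
suff -> : tnth dtup (dec_idx s e a) =
    transv R m (cast_ord (mulnC k 2) (mxtens_index (a, e))) * polyr (U * dL s).
  by apply/memv_imgP; exists (polyr (U * dL s)); rewrite ?polyr_in // lfunE.
apply: weighted_ev_inj => p; rewrite weighted_ev_d evM ev_transv mulrAC.
have [s' sE ->] := ev_polyrE p; have UE := ev_polyr p U.
rewrite sE hornerM dLE eq_sym -sE UE /U /decval.
rewrite (_ : nat_of_ord (cast_ord _ _) = a * 2 + odd e)%N; last first.
  by rewrite /= -ord2_odd.
case: (odd e).
  rewrite horner_transv_odd //; set x := (2 * k)%:R * _.
  have key : (cheb 1 (2 *: 'X) m.-1).[(cos x)%:C] * (sin x)%:C = ((-1) ^+ p)%:C.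
    rewrite horner_chebU prednK // -cosBpihalf cos_compl //.
    by rewrite sin_pihalf mulr1.
  by rewrite !rmorphM /= -key rmorph_nat; ring.
by rewrite addn0 horner_transv_even hornerC mul1r mulrC rmorphM rmorph_nat.
Qed.

(** The factor [Lmx 2 k] of [Msub] is zero unless the labels agree, so each vector of [ctup]
    combines vectors of [dtup] from a single t_l B. *)
Lemma ctup_in q : tnth ctup q \in tsub (Bsub R k m) (transv R m (clab q)).
Proof.
have [y ->] : exists y, q = cast_ord (size_DL k m) y.
  by exists (cast_ord (esym (size_DL k m)) q); rewrite cast_ordKV.
case: (mxtens_indexP y) => i l; rewrite clabE tnth_comb rpred_sum // => q' _.
have [s [e [a ->]]] := dec_idxP q'; rewrite mxE recastE tensmxE LmxE.
case: eqP => [le|_]; last by rewrite mulr0 rmorph0 scale0r mem0v.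
rewrite rpredZ // (_ : l = dlab (dec_idx s e a)) ?dtup_in //.
by rewrite dlabE; apply: val_inj.
Qed.
End Membership.
End Coordinates.

Lemma DCT4_induced :
  subalg_transversal (Bsub R k m) (@transv R k m) /\
  induced_factorization (Bsub R k m) (@transv R k m) (Abasis R k m)
    (toC (DCT4 n)) (toC (Mdec R k m)) (toC (Msub R k m)) (toC (Mind R k hm)).
Proof.
have [|eL eLE] := @lagrange_exists C 'I_n (fun p => chebT_root p).
  by move=> p q /(chebT_root_inj (ltn_ord p) (ltn_ord q)) e; apply: val_inj.
have [dL dLE] := lagrange_exists nodeC_inj.
have cB := ctup_basis eLE; have cin := ctup_in eLE dLE.
have dB := dim_Bsub dLE.
split; first exact: (subalg_transversal_basis cB cin dB (leqnn _)).
exists (ctup eL), (dtup eL), (etup eL); split.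
  split; [exact: base_change_Abasis_c|exact: base_change_c_d
        |exact: base_change_d_e|exact: base_change_Abasis_e].
split.
- by exists clab; apply: adapted_basis_card cB cin dB clab_card.
- by exists dlab; apply: adapted_basis_card (dtup_basis eLE)
    (dtup_in eLE dLE) dB dlab_card.
- exact: dtup_irreducible.
- exact: etup_irreducible.
Qed.
End Algebra.

Theorem theorem6p2 (R : realType) (k m : nat) (hk : (0 < k)%N) (hm : (0 < m)%N) :
  (* decomposition of the t_l B over B, of the result over A, and base change *)
  let Mdec : 'M[R]_(2 * k * m) :=
    recast (size_Kk k m) (Kmx k (2 * m)) *m
    recast (size_KD k m) (Kmx 2 m *t DCT4 k) *m
    recast (size_Y k m) (Ymx k m) in
  let Msub : 'M[R]_(2 * k * m) :=
    recast (size_DL k m) (DCT3 m *t Lmx 2 k) in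
  let Mind : 'M[R]_(2 * k * m) :=
    (Kmx (2 * k) m)^T *m
    recast (size_B k hm) (1%:M *t butterfly m) *m
    (recast (size_KD k m) (Kmx (2 * m) k))^T in
  [/\ DCT4 (2 * k * m) = Mdec *m Msub *m Mind,
      forall j : 'I_m,
        [/\ two_sparse_block (ulsubmx (Yblock R k m j)),
            two_sparse_block (ursubmx (Yblock R k m j)),
            two_sparse_block (dlsubmx (Yblock R k m j))
          & two_sparse_block (drsubmx (Yblock R k m j))],
      subalg_transversal (Bsub R k m) (@transv R k m)
    & induced_factorization (Bsub R k m) (@transv R k m) (Abasis R k m)
        (toC (DCT4 (2 * k * m))) (toC Mdec) (toC Msub) (toC Mind)].
Proof.
move=> Mdec Msub Mind; have [trans fact] := DCT4_induced R hk hm.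
by split=> //; [apply: DCT4_factor | move=> j; apply: two_sparse_Yblock].
Qed.
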